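(* Let $y$ be an algebraic function of $N$ complex variables $x_1,\dots,x_N$ whose monodromy group is solvable. Then $y$ can be represented by rational functions of $x_1,\dots,x_N$ using the arithmetic operations and radicals.
   Context: An algebraic function $y(x)$ of $x=(x_1,\dots,x_N)$ is the multivalued function defined by an irreducible equation $P_n y^n+\dots+P_0=0$ over $\mathbb{C}(x_1,\dots,x_N)$, with $P_i$ complex polynomials in $x$ and $P_n\not\equiv0$. Let $J$ be the discriminant of the equation and $\Sigma=\{P_nJ=0\}\subset\mathbb{C}^N$. At $x_0\in\mathbb{C}^N\setminus\Sigma$ the function $y$ has exactly $n$ germs $y_1,\dots,y_n$ (the germs of analytic functions satisfying the equation). The monodromy group of $y$ is the group of all permutations of $\{y_1,\dots,y_n\}$ induced by analytic continuation along loops in $\mathbb{C}^N\setminus\Sigma$ based at $x_0$; up to isomorphism it does not depend on $x_0$. Representability: $y$ is represented by rational functions using the arithmetic operations and radicals if there are a point $a\in\mathbb{C}^N$ and a finite sequence $g_1,\dots,g_k$ of germs of analytic functions at $a$ such that $g_k$ is a germ of $y$ at $a$ and each $g_i$ either is a germ of a rational function of $x_1,\dots,x_N$, or is a sum, difference, product or quotient (with divisor not identically zero) of germs $g_j$, $g_l$ with $j,l<i$, or satisfies $g_i^q=g_j$ for some $j<i$ and some integer $q\ge1$. *)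

(* Defs.v *)
From HB Require Import structures.
From mathcomp Require Import all_boot all_order all_algebra all_fingroup.
From mathcomp Require Import all_solvable.
From mathcomp Require Import fraction mxpoly complex.
From mathcomp Require Import all_classical all_reals all_analysis.
(* The notations of [mpoly] clash with those of analysis. *)
From mathcomp Require Import -(notations) mpoly.
From mathcomp Require Import zify lra.

Set Implicit Arguments.
Unset Strict Implicit.
Unset Printing Implicit Defensive.

Import Order.TTheory GRing.Theory Num.Theory.
Import numFieldNormedType.Exports.

Local Open Scope classical_set_scope.
Local Open Scope ring_scope.

(* The complex numbers, packaged so that the topology and the norm which
   analysis puts on every [numClosedFieldType] are the ones inferred. *)
Definition cplx (R : realType) : numClosedFieldType := R[i].

Notation cspace R N := 'rV[cplx R]_N.
Notation cpoly R N := (mpoly N (cplx R)).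

Section Discriminant.
Variable A : idomainType.
Implicit Type p : {poly A}.

(* Res(p, p') = (-1)^(n(n-1)/2) a_n J, where n is the degree of p, a_n its
   leading coefficient and J its discriminant; [discriminantE] shows that
   such a J exists in characteristic 0. *)
Definition discriminant p : A :=
  xget 0 [set J | lead_coef p * J =
                  (-1) ^+ 'C((size p).-1, 2) * resultant p p^`()].

Lemma dvd_lead_coef_resultant p :
  (forall n, n.+1%:R != 0 :> A) -> (1 < size p)%N ->
  exists J, resultant p p^`() = lead_coef p * J.
Proof.
move=> charA p_gt1; have sz_p' : size p^`() = (size p).-1.
  have [n szp] : exists n, size p = n.+2 by case: (size p) p_gt1 => [|[|n]] //; exists n.
  apply/eqP; rewrite eqn_leq szp /=; apply/andP; split.
    by apply/leq_sizeP => j hj; rewrite coef_deriv nth_default ?mul0rn ?szp.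
  rewrite ltnNge; apply/negP => /leq_sizeP /(_ n (leqnn n)).
  rewrite coef_deriv -mulr_natr => /eqP; rewrite mulf_eq0 => /orP[].
    by rewrite -[n.+1]/(n.+2.-1) -szp -lead_coefE lead_coef_eq0 -size_poly_eq0 szp.
  by rewrite (negPf (charA n)).
have entry (i j : 'I_((size p^`()).-1 + (size p).-1)) :
    j.+1 = ((size p^`()).-1 + (size p).-1)%N ->
    exists e, Sylvester_mx p p^`() i j = lead_coef p * e.
  move=> jE; rewrite Sylvester_mxE /=; case: splitP => k _;
    have := ltn_ord k; move: (nat_of_ord k) (nat_of_ord j) jE => {}k {}j.
    rewrite sz_p' => jE; rewrite leq_eqVlt => /orP[/eqP kE|kE].
      exists ((k <= j)%N%:R); rewrite mulr_natr lead_coefE.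
      by congr (_`__ *+ _); lia.
    exists 0; rewrite mulr0 nth_default ?mul0rn //.
    by case: (size p) p_gt1 jE kE => [|[|n]] //=; lia.
  rewrite sz_p' => jE; rewrite leq_eqVlt => /orP[/eqP kE|kE].
    exists ((j - k).+1%:R * (k <= j)%N%:R).
    rewrite mulrA !mulr_natr coef_deriv lead_coefE.
    congr (_`__ *+ _ *+ _);
      by case: (size p) p_gt1 jE kE => [|[|n]] //=; lia.
  exists 0; rewrite mulr0 coef_deriv nth_default ?mul0rn //.
  by case: (size p) p_gt1 jE kE => [|[|n]] //=; lia.
have [j jE] : exists j : 'I_((size p^`()).-1 + (size p).-1),
    j.+1 = ((size p^`()).-1 + (size p).-1)%N.
  have lt : (((size p^`()).-1 + (size p).-1).-1
             < (size p^`()).-1 + (size p).-1)%N by lia.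
  by exists (Ordinal lt); exact: ltn_predK lt.
have /choice[e eE] := fun i => entry i j jE.
exists (\sum_i e i * cofactor (Sylvester_mx p p^`()) i j).
rewrite /resultant (expand_det_col _ j) mulr_sumr.
by apply: eq_bigr => i _; rewrite eE mulrA.
Qed.

Lemma discriminantE p :
  (forall n, n.+1%:R != 0 :> A) -> (1 < size p)%N ->
  lead_coef p * discriminant p =
  (-1) ^+ 'C((size p).-1, 2) * resultant p p^`().
Proof.
move=> charA /(dvd_lead_coef_resultant charA)[J JE]; rewrite /discriminant.
case: xgetP => [_ -> //|/(_ ((-1) ^+ 'C((size p).-1, 2) * J)) []].
by rewrite /= JE mulrCA.
Qed.

End Discriminant.

Section Defs.
Variables (R : realType) (N : nat).
Local Notation C := (cplx R).
Local Notation V := (cspace R N).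

Definition peval (x : V) (p : cpoly R N) : C := meval (fun i => x 0 i) p.

Definition monomial (m : multinom N) (x : V) : C :=
  \prod_(i < N) x 0 i ^+ m i.

(* The partial sums range over the multi-indices of total degree < d; as the
   series converges absolutely, this choice is immaterial. *)
Definition analytic_at (a : V) (f : V -> C) : Prop :=
  exists c : multinom N -> C, \forall x \near a,
    cvgn (fun d => \sum_(m : bmultinom N d) `|c m * monomial m (x - a)|) /\
    (fun d => \sum_(m : bmultinom N d) c m * monomial m (x - a)) @ \oo --> f x.

(* Germs at a are represented by total functions, of which only the values near
   a matter. *)
Definition germ_eq (a : V) (f g : V -> C) : Prop := \forall x \near a, f x = g x.

Lemma cpoly_char0 n : n.+1%:R != 0 :> cpoly R N.
Proof. by rewrite -mpolyC_nat mpolyC_eq0 pnatr_eq0. Qed.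

Section AlgebraicFunction.
(* P is the equation P_n y^n + ... + P_0 = 0. *)
Variable P : {poly cpoly R N}.

Definition irreducible_equation : Prop :=
  irreducible_poly (map_poly (@tofrac (cpoly R N)) P).

Definition Sigma : set V :=
  [set x | peval x (lead_coef P * discriminant P) = 0].

Definition is_germ_of (a : V) (f : V -> C) : Prop :=
  analytic_at a f /\ \forall x \near a, (map_poly (peval x) P).[f x] = 0.

Definition lists_germs_of (a : V) (ys : 'I_(size P).-1 -> V -> C) : Prop :=
  [/\ forall i, is_germ_of a (ys i),
      forall i j, germ_eq a (ys i) (ys j) -> i = j &
      forall f, is_germ_of a f -> exists i, germ_eq a f (ys i)].

Definition loop_in (A : set V) (a : V) (gamma : R -> V) : Prop :=
  [/\ {within `[0, 1], continuous gamma},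
      gamma 0 = a, gamma 1 = a & forall t : R, t \in `[0, 1] -> A (gamma t)].

(* F t represents a germ at gamma t. *)
Definition continues_along (gamma : R -> V) (f g : V -> C) : Prop :=
  exists F : R -> V -> C,
  [/\ forall t : R, t \in `[0, 1] -> analytic_at (gamma t) (F t),
      forall t : R, t \in `[0, 1] ->
        \forall s \near t, s \in `[0, 1] -> germ_eq (gamma s) (F s) (F t),
      germ_eq (gamma 0) (F 0) f &
      germ_eq (gamma 1) (F 1) g].

(* This set is a group: see [monodromy_group_set]. *)
Definition monodromy_group (x0 : V) (ys : 'I_(size P).-1 -> V -> C) :
    {set {perm 'I_(size P).-1}} :=
  finset (fun s : {perm _} => `[< exists2 gamma, loop_in (~` Sigma) x0 gamma &
                       forall i, continues_along gamma (ys i) (ys (s i)) >]).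

End AlgebraicFunction.

Definition is_rational_germ (a : V) (f : V -> C) : Prop :=
  exists p q : cpoly R N,
    peval a q != 0 /\ germ_eq a f (fun x => peval x p / peval x q).

(* A quotient g j / g l may be analytic at a even though g l vanishes there, so
   it is not computed pointwise. *)
Definition germ_step (a : V) k (g : 'I_k -> V -> C) (i : 'I_k) : Prop :=
  [\/ is_rational_germ a (g i),
      exists j l : 'I_k, [/\ (j < i)%N, (l < i)%N &
        [\/ germ_eq a (g i) (fun x => g j x + g l x),
            germ_eq a (g i) (fun x => g j x - g l x),
            germ_eq a (g i) (fun x => g j x * g l x) |
            ~ germ_eq a (g l) (fun=> 0) /\
            germ_eq a (fun x => g i x * g l x) (g j)]] |
      exists (j : 'I_k) (q : nat), [/\ (j < i)%N, (1 <= q)%N &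
        germ_eq a (fun x => g i x ^+ q) (g j)]].

Definition representable_by_radicals (P : {poly cpoly R N}) : Prop :=
  exists (a : V) (k : nat) (g : 'I_k.+1 -> V -> C),
    [/\ forall i, analytic_at a (g i),
        forall i, germ_step a g i &
        is_germ_of P a (g ord_max)].

End Defs.

Arguments lists_germs_of {R N} P a ys.
Arguments monodromy_group {R N} P x0 ys.

Section Concatenation.
Variables (R : realType) (T : Type).

Definition concat (f g : R -> T) (t : R) : T :=
  if t <= 2^-1 then f (2 * t) else g (2 * t - 1).

Lemma near_concat (t : R) (Q : R -> Prop) :
  (t <= 2^-1 -> \forall s \near 2 * t, s \in `[0, 1] -> Q (s / 2)) ->
  (2^-1 <= t -> \forall s \near 2 * t - 1, s \in `[0, 1] -> s != 0 ->
                  Q ((s + 1) / 2)) ->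
  \forall s \near t, s \in `[0, 1] -> Q s.
Proof.
move=> Q1 Q2.
have c1 : (fun s : R => 2 * s) @ t --> 2 * t by exact: mulrl_continuous.
have c2 : (fun s : R => 2 * s - 1) @ t --> 2 * t - 1.
  by apply: cvgB => //; exact: cvg_cst.
have L : \forall s \near t, s \in `[0, 1] -> s <= 2^-1 -> Q s.
  have [/Q1 /c1 h|gt] := leP t 2^-1.
    near=> s => s01 s2.
    have : 2 * s \in `[0, 1] -> Q (2 * s / 2) by near: s; exact: h.
    rewrite mulrAC mulfV ?mul1r ?pnatr_eq0 //; apply.
    by move: s01; rewrite !in_itv /=; lra.
  near=> s => _; rewrite leNgt => /negP; elim.
  by near: s; exact: lt_nbhsr.
have G : \forall s \near t, s \in `[0, 1] -> 2^-1 < s -> Q s.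
  have [/Q2 /c2 h|lt] := leP 2^-1 t.
    near=> s => s01 s2.
    have : 2 * s - 1 \in `[0, 1] -> 2 * s - 1 != 0 -> Q ((2 * s - 1 + 1) / 2).
      by near: s; exact: h.
    rewrite subrK mulrAC mulfV ?mul1r ?pnatr_eq0 //; apply.
      by move: s01; rewrite !in_itv /=; lra.
    by apply/eqP; lra.
  near=> s => _; rewrite ltNge => /negP; elim; apply: ltW.
  by near: s; exact: lt_nbhsl.
near=> s => s01; have [s2|s2] := leP s 2^-1.
  by move: s01 s2; near: s.
by move: s01 s2; near: s.
Unshelve. all: by end_near.
Qed.

Lemma concat_l (f g : R -> T) (s : R) : s \in `[0, 1] -> concat f g (s / 2) = f s.
Proof.
rewrite in_itv /= => /andP[s0 s1]; rewrite /concat ifT; last by lra.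
by congr f; lra.
Qed.

Lemma concat_r (f g : R -> T) (s : R) : s \in `[0, 1] -> s != 0 ->
  concat f g ((s + 1) / 2) = g s.
Proof.
rewrite in_itv /= => /andP[s0 s1] /eqP sn0; rewrite /concat ifF; last first.
  by apply/negbTE; rewrite -ltNge; lra.
by congr g; lra.
Qed.

Lemma concatP (t : R) (P : T -> Prop) (f g : R -> T) : t \in `[0, 1] ->
  (forall s, s \in `[0, 1] -> P (f s)) -> (forall s, s \in `[0, 1] -> P (g s)) ->
  P (concat f g t).
Proof.
rewrite in_itv /= => /andP[t0 t1] Pf Pg; rewrite /concat; case: leP => h.
  by apply: Pf; rewrite in_itv /=; lra.
by apply: Pg; rewrite in_itv /=; lra.
Qed.

Lemma concat0 (f g : R -> T) : concat f g 0 = f 0.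
Proof. by rewrite /concat invr_ge0 ler0n mulr0. Qed.

Lemma concat1 (f g : R -> T) : concat f g 1 = g 1.
Proof.
rewrite /concat ifF; last by apply/negbTE; rewrite -ltNge; lra.
by congr g; lra.
Qed.

End Concatenation.

Section Group.
Variables (R : realType) (N : nat).
Local Notation C := (cplx R).
Local Notation V := (cspace R N).
Variable P : {poly cpoly R N}.

Lemma itv0 : (0 : R) \in `[0, 1]. Proof. by rewrite in_itv /= lexx ler01. Qed.
Lemma itv1 : (1 : R) \in `[0, 1]. Proof. by rewrite in_itv /= lexx ler01. Qed.

Lemma loop_inP (A : set V) a (gamma : R -> V) :
  loop_in A a gamma <->
  [/\ forall t : R, t \in `[0, 1] -> forall U, nbhs (gamma t) U ->
        \forall s \near t, s \in `[0, 1] -> U (gamma s),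
      gamma 0 = a, gamma 1 = a & forall t, t \in `[0, 1] -> A (gamma t)].
Proof.
split=> -[c g0 g1 gA]; split => //.
  by move=> t t01 U; move/subspace_continuousP: c => /(_ t t01); exact.
by apply/subspace_continuousP => t t01 U; exact: c.
Qed.

Lemma loop_concat (A : set V) a (gamma delta : R -> V) :
  loop_in A a gamma -> loop_in A a delta -> loop_in A a (concat gamma delta).
Proof.
move=> /loop_inP[c g0 g1 gA] /loop_inP[d d0 d1 dA]; apply/loop_inP; split.
- move=> t t01 U tU; apply: near_concat => ht.
    have t2 : 2 * t \in `[0, 1] by move: t01 ht; rewrite !in_itv /=; lra.
    move: tU; rewrite /concat ht => /(c _ t2).
    by apply: filterS => s h s01; rewrite [X in U X]concat_l //; exact: h.
  have t2 : 2 * t - 1 \in `[0, 1] by move: t01 ht; rewrite !in_itv /=; lra.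
  have tE : concat gamma delta t = delta (2 * t - 1).
    rewrite /concat; case: leP => // h; have -> : t = 2^-1 by lra.
    by rewrite mulfV ?pnatr_eq0 // subrr g1 d0.
  move: tU; rewrite tE => /(d _ t2).
  by apply: filterS => s h s01 sn0; rewrite [X in U X]concat_r //; exact: h.
- by rewrite !concat0.
- by rewrite !concat1.
- by move=> t t01; exact: concatP.
Qed.

Lemma germ_eq_sym a (f g : V -> C) : germ_eq a f g -> germ_eq a g f.
Proof. by apply: filterS => x ->. Qed.

Lemma germ_eq_trans a (f g h : V -> C) :
  germ_eq a f g -> germ_eq a g h -> germ_eq a f h.
Proof. by apply: filterS2 => x -> ->. Qed.

Lemma germ_eq_refl a (f : V -> C) : germ_eq a f f.
Proof. by rewrite /germ_eq; near=> x. Unshelve. all: by end_near. Qed.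

Lemma continues_concat (A : set V) a (gamma delta : R -> V) f g h :
  loop_in A a gamma -> loop_in A a delta ->
  continues_along gamma f g -> continues_along delta g h ->
  continues_along (concat gamma delta) f h.
Proof.
move=> /loop_inP[c g0 g1 gA] /loop_inP[d d0 d1 dA].
move=> [F [Fan Fc F0 F1]] [G [Gan Gc G0 G1]].
have FG : germ_eq a (F 1) (G 0).
  rewrite g1 in F1; rewrite d0 in G0; apply: germ_eq_trans F1 _.
  exact: germ_eq_sym.
exists (concat F G); split.
- move=> t; rewrite in_itv /= => t01; rewrite /concat; case: leP => ht.
    by apply: Fan; rewrite in_itv /=; lra.
  by apply: Gan; rewrite in_itv /=; lra.
- move=> t t01; apply: near_concat => ht.
    have t2 : 2 * t \in `[0, 1] by move: t01 ht; rewrite !in_itv /=; lra.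
    have := Fc _ t2; apply: filterS => s hs s01.
    by rewrite !concat_l // /concat ht; exact: hs.
  have t2 : 2 * t - 1 \in `[0, 1] by move: t01 ht; rewrite !in_itv /=; lra.
  have [th|th] := leP t 2^-1; last first.
    have := Gc _ t2; apply: filterS => s hs s01 sn0.
    by rewrite !concat_r // /concat leNgt th; exact: hs.
  have tE : t = 2^-1 by lra.
  have t0 : 2 * t - 1 = 0 by lra.
  have -> : concat F G t = F 1.
    by rewrite /concat th; congr F; lra.
  have FGi : nbhs (delta 0) [set y | germ_eq y (F 1) (G 0)].
    by rewrite d0; exact: (nbhs_interior (A := [set x | F 1 x = G 0 x]) FG).
  rewrite t0; have := d _ itv0 _ FGi.
  apply: filterS2 (Gc _ itv0) => s hs hFG s01 sn0; rewrite !concat_r //.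
  by apply: germ_eq_trans (hs s01) _; apply: germ_eq_sym; exact: hFG.
- by rewrite !concat0.
- by rewrite !concat1.
Qed.

Lemma monodromy_groupP x0 ys (s : {perm 'I_(size P).-1}) :
  reflect (exists2 gamma, loop_in (~` Sigma P) x0 gamma &
                       forall i, continues_along gamma (ys i) (ys (s i)))
  (s \in monodromy_group P x0 ys).
Proof. by rewrite /monodromy_group finset.in_set; exact: asboolP. Qed.

Lemma monodromy_group_set x0 ys : ~ Sigma P x0 -> lists_germs_of P x0 ys ->
  group_set (monodromy_group P x0 ys).
Proof.
move=> x0S [ysP _ _]; apply/group_setP; split.
  apply/monodromy_groupP; exists (fun=> x0).
    by split=> //; apply/continuous_subspaceT => ?; exact: cvg_cst.
  move=> i; rewrite perm1; exists (fun=> ys i); split=> [t _|t _||].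
  - by case: (ysP i).
  - by near=> s => _; exact: germ_eq_refl.
  - exact: germ_eq_refl.
  - exact: germ_eq_refl.
move=> s t /monodromy_groupP[gamma gl gc] /monodromy_groupP[delta dl dc].
apply/monodromy_groupP; exists (concat gamma delta).
  exact: loop_concat gl dl.
by move=> i; rewrite permM; exact: continues_concat gl dl (gc i) (dc _).
Unshelve. all: by end_near.
Qed.

End Group.

(* Main.v *)
Require Import Defs.
From HB Require Import structures.
From mathcomp Require Import all_boot all_order all_algebra all_fingroup.
From mathcomp Require Import all_solvable.
From mathcomp Require Import fraction mxpoly complex.
From mathcomp Require Import all_classical all_reals all_analysis.
From mathcomp Require Import -(notations) mpoly.
From mathcomp Require Import zify ring lra.

Set Implicit Arguments.
Unset Strict Implicit.
Unset Printing Implicit Defensive.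

Import Order.TTheory GRing.Theory Num.Theory.
Import numFieldNormedType.Exports.

Local Open Scope classical_set_scope.
Local Open Scope ring_scope.

(** Let n be the degree of the equation, [ys] its n germs at [x0] and G its
    monodromy group.  Everything takes place in the polynomial ring
    W = C[Y_1, ..., Y_n], on which G acts by permuting the variables, together with
    the evaluation map that sends [w] to the germ [w (ys)] at [x0].

    Algebra.  If G is solvable, every element of W is obtained from elements of W
    fixed by G with sums, products and root extractions ([solvable_radical]).  By
    induction on the order of G this is the case of a normal subgroup H of prime
    index: an H-invariant is a combination of Lagrange resolvents, and a power of
    each of these is G-invariant ([prime_step]).  Applied to the variable Y_1 and
    evaluated at [ys], this writes a germ of y by radicals in germs [w (ys)] with [w]
    fixed by G.  No division by a function occurs, so that all germs are analytic
    at [x0] itself.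

    Analysis.  It remains to see that [w (ys)] is a rational germ when [w] is fixed
    by G ([invariant_rational]).  Off Sigma the n roots are locally analytic functions
    ([local_branches], from the implicit function theorem [simple_root_germ]) and
    can be continued along segments inside small boxes ([reach_step]); two
    continuations to the same point differ by an element of G ([reach_unique]), so
    the value of [w] is a single-valued function on the set A of points that can be
    reached from [x0].  After multiplication by a power of the leading coefficient
    it grows at most like a power of the distance ([fibre_growth]).

    Such a function is a polynomial ([single_valued_polynomial]), by the following
    one-variable argument on each complex line through [x0].  Let [g] be the
    restriction to the line with coordinate [t], let [T] be its Taylor polynomial at
    t = 0 whose degree is the growth exponent, and put
      H = ((g - T) / t^(d+1))^nu D t   on A,     H = 0   elsewhere,
    where D is an equation of Sigma.  The first factor is bounded near t = 0 and
    near Sigma, so H is continuous on the whole line, being killed by D t at the bad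
    points; and H tends to 0 at infinity if [nu] is large.  Hence |H| attains its
    maximum, necessarily at a point near which H is analytic, and the maximum
    principle gives H = 0, that is, g = T.  This one step plays the parts of Riemann's
    theorem on removable singularities and of Liouville's theorem.  Since all Taylor
    coefficients of high degree vanish on all lines, the function is a polynomial
    near [x0].

    Analytic functions are handled through coherent sequences of polynomials with
    bounded weighted norms ([series_at]), which makes the Cauchy product and the
    solution of fixed-point equations statements about finite sums. *)

(** * The complex modulus and complex neighbourhoods *)

Section Modulus.
Variable R : realType.
Local Notation C := (cplx R).
Implicit Types (z w : C).

(** The modulus with values in [R], where the order is total, instead of in [C]. *)
Definition nm z : R := Normc.normc z.
Definition ofR (x : R) : C := real_complex R x.

HB.instance Definition _ := GRing.RMorphism.copy ofR (real_complex R).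

Lemma nmE z : `|z| = ofR (nm z). Proof. by []. Qed.

Lemma nmM z w : nm (z * w) = nm z * nm w. Proof. exact: Normc.normcM. Qed.
Lemma nm0 : nm 0 = 0. Proof. exact: Normc.normc0. Qed.
Lemma nm1 : nm 1 = 1. Proof. exact: Normc.normc1. Qed.
Lemma nmN z : nm (- z) = nm z. Proof. exact: normcN. Qed.
Lemma nmV z : nm z^-1 = (nm z)^-1. Proof. exact: Normc.normcV. Qed.
Lemma nmD z w : nm (z + w) <= nm z + nm w. Proof. exact: le_normcD. Qed.
Lemma nmB z w : nm (z - w) <= nm z + nm w. Proof. by rewrite -(nmN w) nmD. Qed.
Lemma nmBC z w : nm (z - w) = nm (w - z). Proof. by rewrite -nmN opprB. Qed.
Lemma nm_ge0 z : 0 <= nm z. Proof. by case: z => a b; exact: sqrtr_ge0. Qed.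
Lemma nm_eq0 z : (nm z == 0) = (z == 0).
Proof. by apply/eqP/eqP => [|->]; [exact: Normc.eq0_normc | exact: nm0]. Qed.
Lemma nm_gt0 z : (0 < nm z) = (z != 0).
Proof. by rewrite lt_neqAle nm_ge0 andbT eq_sym nm_eq0. Qed.
Lemma nmX z n : nm (z ^+ n) = nm z ^+ n.
Proof. by elim: n => [|n IH]; rewrite ?expr0 ?nm1 // !exprS nmM IH. Qed.
Lemma nm_le_dist z w : nm z <= nm w + nm (z - w).
Proof. by rewrite -{1}(subrK w z) addrC nmD. Qed.
Lemma nm_tri z w u : nm (z - u) <= nm (z - w) + nm (w - u).
Proof. by rewrite -[z - u](subrKA w) nmD. Qed.
Lemma nm_sum I (s : seq I) (P : pred I) (F : I -> C) :
  nm (\sum_(i <- s | P i) F i) <= \sum_(i <- s | P i) nm (F i).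
Proof.
elim/big_rec2: _ => [|i y1 y2 _ le]; first by rewrite nm0.
by apply: le_trans (nmD _ _) _; rewrite lerD2l.
Qed.
Lemma nm_prod I (s : seq I) (P : pred I) (F : I -> C) :
  nm (\prod_(i <- s | P i) F i) = \prod_(i <- s | P i) nm (F i).
Proof. exact: (big_morph _ nmM nm1). Qed.

Lemma nm_ofR (x : R) : nm (ofR x) = `|x|.
Proof. by rewrite /nm /ofR /= expr0n /= addr0 sqrtr_sqr. Qed.

Lemma ofR_lt (x y : R) : (ofR x < ofR y) = (x < y). Proof. exact: ltcR. Qed.

Lemma posC (e : C) : 0 < e -> exists2 x, 0 < x & e = ofR x.
Proof.
move=> e0; have /complex_realP[x ex] : e \is Num.real by rewrite realE ltW.
by exists x => //; move: e0; rewrite ex ltcR.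
Qed.

Lemma near_cplxP (a : C) (P : C -> Prop) :
  (\forall z \near a, P z) <->
  exists2 e : R, 0 < e & forall z, nm (z - a) < e -> P z.
Proof.
apply: (iff_trans (nbhs_ballP _ _)); split=> -[e e0 h].
  have [x x0 ex] := posC e0; exists x => // z zx; apply: h.
  by rewrite -ball_normE /= nmE ex ofR_lt nmBC.
exists (ofR e); first by rewrite /= -(rmorph0 ofR) ofR_lt.
by move=> z; rewrite -ball_normE /= nmE ofR_lt nmBC => /h.
Qed.

Lemma near_cspaceP N (a : cspace R N) (P : cspace R N -> Prop) :
  (\forall x \near a, P x) <->
  exists2 e : R, 0 < e & forall x : cspace R N, (forall i, nm (x 0 i - a 0 i) < e) -> P x.
Proof.
apply: (iff_trans (nbhs_ballP _ _)); split=> -[e e0 h].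
  have [x x0 ex] := posC e0; exists x => // z zx; apply: h; split=> // i j.
  by rewrite ord1 -ball_normE /= nmE ex ofR_lt nmBC.
exists (ofR e); first by rewrite /= -(rmorph0 ofR) ofR_lt.
move=> z [_ zb]; apply: h => i; have := zb 0 i.
by rewrite -ball_normE /= nmE ofR_lt nmBC.
Qed.

Lemma cvg_cplxP (u : nat -> C) (l : C) :
  (u @ \oo --> l) <->
  (forall e : R, 0 < e -> exists K, forall d, (K <= d)%N -> nm (u d - l) < e).
Proof.
split=> [ul e e0|h].
  have /ul : nbhs l [set z | nm (z - l) < e] by apply/near_cplxP; exists e.
  by case=> K _ KP; exists K => d Kd; exact: KP.
move=> A /near_cplxP[e e0 eA]; have [K KP] := h _ e0.
by exists K => // d /= Kd; apply: eA; exact: KP.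
Qed.

(** The intervals of centre [u d] and radius [2 M 2^-d] are nested; the limit is the
    supremum of their left endpoints. *)
Lemma geometric_limit_real (u : nat -> R) (M : R) :
  (forall d, `|u d.+1 - u d| <= M * 2^-1 ^+ d) ->
  exists l, forall d, `|l - u d| <= 2 * M * 2^-1 ^+ d.
Proof.
move=> hu; set q := (2^-1 : R).
have qE d : q ^+ d = 2 * q ^+ d.+1 by rewrite exprS mulrA mulfV ?mul1r ?pnatr_eq0.
pose a d := u d - 2 * M * q ^+ d; pose b d := u d + 2 * M * q ^+ d.
have aS d : a d <= a d.+1.
  by have := hu d; rewrite -/q /a (qE d) ler_distl => /andP[]; lra.
have bS d : b d.+1 <= b d.
  by have := hu d; rewrite -/q /b (qE d) ler_distl => /andP[]; lra.
have ab d : a d <= b d.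
  have := le_trans (normr_ge0 _) (hu d); rewrite -/q /a /b; lra.
have am m k : a m <= a (m + k)%N.
  by elim: k => [|k IH]; rewrite ?addn0 // addnS (le_trans IH).
have bm m k : b (m + k)%N <= b m.
  by elim: k => [|k IH]; rewrite ?addn0 // addnS (le_trans _ IH).
have abm m d : a m <= b d.
  by apply: le_trans (am m d) (le_trans (ab _) _); rewrite addnC bm.
pose A := range a.
have supA : has_sup A.
  by split; [exists (a 0%N), 0%N | exists (b 0%N) => _ [m _ <-]].
exists (sup A) => d; rewrite ler_distl; apply/andP; split.
  have : a d <= sup A by apply: sup_upper_bound => //; exists d.
  by rewrite /a.
have : sup A <= b d by apply: ge_sup => [|_ [m _ <-] //]; exists (a 0%N), 0%N.
by [].
Qed.

Lemma nm_le_ReIm z : nm z <= `|complex.Re z| + `|complex.Im z|.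
Proof.
rewrite {1}(complexE z); apply: le_trans (nmD _ _) _.
rewrite nmM -[real_complex R _]/(ofR _) nm_ofR.
have -> : nm ('i%C : C) = 1.
  by rewrite /nm /= expr0n /= add0r expr1n sqrtr1.
by rewrite mul1r -[real_complex R (complex.Im z)]/(ofR _) nm_ofR.
Qed.

Lemma Re_le_nm z : `|complex.Re z| <= nm z.
Proof.
case: z => a b /=; rewrite -sqrtr_sqr /nm /=; apply: ler_wsqrtr.
by rewrite lerDl sqr_ge0.
Qed.

Lemma Im_le_nm z : `|complex.Im z| <= nm z.
Proof.
case: z => a b /=; rewrite -sqrtr_sqr /nm /=; apply: ler_wsqrtr.
by rewrite lerDr sqr_ge0.
Qed.

Lemma geometric_limit (u : nat -> C) (M : R) :
  (forall d, nm (u d.+1 - u d) <= M * 2^-1 ^+ d) ->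
  exists l, forall d, nm (l - u d) <= 4 * M * 2^-1 ^+ d.
Proof.
move=> hu.
have [|x hx] := @geometric_limit_real (@complex.Re R \o u) M.
  move=> d /=; apply: le_trans _ (hu d).
  by rewrite (_ : _ - _ = complex.Re (u d.+1 - u d)) ?Re_le_nm //; case: (u _) (u _) => ? ? [].
have [|y hy] := @geometric_limit_real (@complex.Im R \o u) M.
  move=> d /=; apply: le_trans _ (hu d).
  by rewrite (_ : _ - _ = complex.Im (u d.+1 - u d)) ?Im_le_nm //; case: (u _) (u _) => ? ? [].
exists (Complex x y) => d; apply: le_trans (nm_le_ReIm _) _.
have := hx d; have := hy d; rewrite /=; case: (u d) => a b /=; lra.
Qed.

End Modulus.

(** * Weighted norms of polynomials in several variables *)

Section WeightedNorm.
Variables (R : realType) (N : nat).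
Local Notation C := (cplx R).
Implicit Types (p q : cpoly R N) (r : R) (m : multinom N).

(** A weighted l1-norm of the coefficients.  It bounds the polynomial on the polydisc
    of radius [r] and, unlike the sup norm there, it is read off the coefficients:
    this is what the method of majorants needs. *)
Definition wn r p : R := \sum_(m <- msupp p) nm (mcoeff m p) * r ^+ mdeg m.

Lemma wnE r p (s : seq (multinom N)) : uniq s -> {subset msupp p <= s} ->
  wn r p = \sum_(m <- s) nm (mcoeff m p) * r ^+ mdeg m.
Proof.
move=> s_uniq ps; rewrite (bigID (fun m => m \in msupp p)) /= [X in _ + X]big1.
  rewrite addr0 -big_filter; apply: perm_big; apply: uniq_perm.
  - exact: msupp_uniq.
  - exact: filter_uniq.
  - by move=> m; rewrite mem_filter; case: (boolP (m \in _)) => // /ps ->.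
by move=> m; rewrite mcoeff_msupp negbK => /eqP ->; rewrite nm0 mul0r.
Qed.

Lemma wn_ge0 r p : 0 <= r -> 0 <= wn r p.
Proof.
by move=> r0; apply: sumr_ge0 => m _; rewrite mulr_ge0 ?nm_ge0 ?exprn_ge0.
Qed.

Lemma wn0 r : wn r 0 = 0.
Proof. by rewrite /wn msupp0 big_nil. Qed.

Lemma wnD r p q : 0 <= r -> wn r (p + q) <= wn r p + wn r q.
Proof.
move=> r0; pose s := undup (msupp p ++ msupp q).
have s_uniq : uniq s by exact: undup_uniq.
rewrite !(@wnE r _ s) //; last 3 first.
- by move=> m mq; rewrite mem_undup mem_cat mq orbT.
- by move=> m mp; rewrite mem_undup mem_cat mp.
- move=> m; rewrite mem_undup mem_cat !mcoeff_msupp mcoeffD.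
  by apply: contraR; rewrite negb_or !negbK => /andP[/eqP -> /eqP ->]; rewrite addr0.
rewrite -big_split; apply: ler_sum => m _ /=.
by rewrite -mulrDl ler_wpM2r ?exprn_ge0 // mcoeffD nmD.
Qed.

Lemma wn_sum I (s : seq I) (P : pred I) (F : I -> cpoly R N) r : 0 <= r ->
  wn r (\sum_(i <- s | P i) F i) <= \sum_(i <- s | P i) wn r (F i).
Proof.
move=> r0; elim/big_rec2: _ => [|i y1 y2 _ le]; first by rewrite wn0.
by apply: le_trans (wnD _ _ r0) _; rewrite lerD2l.
Qed.

Lemma wnZX r (c : C) m : wn r (c *: mpolyX _ m) = nm c * r ^+ mdeg m.
Proof.
rewrite (@wnE r _ [:: m]) ?big_seq1 ?mcoeffZ ?mcoeffX ?eqxx ?mulr1 //.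
move=> k; rewrite mcoeff_msupp mcoeffZ mcoeffX inE [k == m]eq_sym.
by case: (m =P k) => // _; rewrite mulr0 eqxx.
Qed.

Lemma wnM r p q : 0 <= r -> wn r (p * q) <= wn r p * wn r q.
Proof.
move=> r0; rewrite {1}(mpolyE p) {1}(mpolyE q) big_distrlr /=.
apply: le_trans (wn_sum _ _ _ r0) _; rewrite /wn big_distrlr /=.
apply: ler_sum => m _; apply: le_trans (wn_sum _ _ _ r0) _.
apply: ler_sum => k _.
rewrite -scalerAl -scalerAr scalerA -mpolyXD [leLHS]wnZX mdegD exprD nmM.
by rewrite mulrACA.
Qed.

Lemma wnN r p : wn r (- p) = wn r p.
Proof.
rewrite (@wnE r (- p) (msupp p)) ?msupp_uniq //; last first.
  by move=> m; rewrite !mcoeff_msupp mcoeffN oppr_eq0.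
by apply: eq_bigr => m _; rewrite mcoeffN nmN.
Qed.

Lemma wnC r (c : C) : wn r (mpolyC N c) = nm c.
Proof.
have := wnZX r c (mnm0 (n := N)); rewrite mdeg0 expr0 mulr1 mpolyX0 => <-.
by rewrite -mul_mpolyC mulr1.
Qed.

Lemma wn_mono r s p : 0 <= r <= s -> wn r p <= wn s p.
Proof.
move=> /andP[r0 rs]; apply: ler_sum => m _.
by rewrite ler_wpM2l ?nm_ge0 // lerXn2r ?nnegrE //; apply: le_trans rs.
Qed.

Lemma nm_peval r p (x : cspace R N) : (forall i, nm (x 0 i) <= r) ->
  nm (peval x p) <= wn r p.
Proof.
move=> xr; rewrite /peval mevalE; apply: le_trans (nm_sum _ _ _) _.
apply: ler_sum => m _; rewrite nmM ler_wpM2l ?nm_ge0 // nm_prod mdegE.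
rewrite -prodrXr; apply: ler_prod => i _; rewrite nmX exprn_ge0 ?nm_ge0 //=.
by rewrite lerXn2r ?nnegrE ?nm_ge0 //; apply: le_trans (xr i); exact: nm_ge0.
Qed.

(** Membership in the d-th power of the ideal of the origin. *)
Definition low d p := forall m, (mdeg m < d)%N -> mcoeff m p = 0.

(** Each monomial of degree at least [d] shrinks by [(rho / r) ^ d] or more when the
    radius goes from [r] to [rho]. *)
Lemma wn_low d rho r p : 0 <= rho <= r -> 0 < r -> low d p ->
  wn rho p <= (rho / r) ^+ d * wn r p.
Proof.
move=> /andP[rho0 rho_r] r0 lp.
rewrite /wn mulr_sumr big_seq [leRHS]big_seq; apply: ler_sum => m mp.
have md : (d <= mdeg m)%N.
  by rewrite leqNgt; apply: contraTN mp => /lp; rewrite mcoeff_msupp => ->; rewrite eqxx.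
have q0 : 0 <= rho / r by rewrite divr_ge0 // ltW.
have q1 : rho / r <= 1 by rewrite ler_pdivrMr // mul1r.
have rE : rho = rho / r * r by rewrite mulfVK // gt_eqF.
rewrite {1}rE exprMn mulrCA ler_wpM2r ?mulr_ge0 ?nm_ge0 ?exprn_ge0 ?(ltW r0) //.
by rewrite ler_wiXn2l.
Qed.

Lemma low_le d e p : (d <= e)%N -> low e p -> low d p.
Proof. by move=> de lp m md; apply: lp; exact: leq_trans de. Qed.

Lemma low_0 d : low d 0. Proof. by move=> m _; rewrite mcoeff0. Qed.

Lemma lowD d p q : low d p -> low d q -> low d (p + q).
Proof. by move=> lp lq m md; rewrite mcoeffD lp ?lq ?addr0. Qed.

Lemma lowM d e p q : low d p -> low e q -> low (d + e) (p * q).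
Proof.
move=> lp lq m md; rewrite mcoeffM big1 // => -[k l] /eqP /= /(congr1 mdeg); rewrite mdegD => mE.
have [kd|kd] := ltnP (mdeg k) d; first by rewrite lp ?mul0r.
by rewrite lq ?mulr0 //; lia.
Qed.

Lemma lowMl d p q : low d p -> low d (q * p).
Proof. by move=> lp; rewrite -[d]add0n; apply: lowM. Qed.

Lemma lowMr d p q : low d p -> low d (p * q).
Proof. by move=> lp; rewrite -[d]addn0; apply: lowM. Qed.

Lemma low1E p : mcoeff mnm0 p = 0 -> low 1 p.
Proof. by move=> p0 m; rewrite ltnS leqn0 mdeg_eq0 => /eqP ->. Qed.

Lemma low_telescope (p : nat -> cpoly R N) :
  (forall d, low d (p d.+1 - p d)) -> forall d e, (d <= e)%N -> low d (p e - p d).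
Proof.
move=> pl d e /subnKC <-; elim: (e - d)%N => [|k IH].
  by rewrite addn0 subrr; exact: low_0.
rewrite addnS -(subrKA (p (d + k)%N)); apply: lowD => //.
by apply: low_le (pl _); exact: leq_addr.
Qed.

(** [p - q] divides [F.[p] - F.[q]]. *)
Lemma low_horner_sub d (F : {poly cpoly R N}) p q :
  low d (p - q) -> low d (F.[p] - F.[q]).
Proof.
move=> lpq; elim/poly_ind: F => [|F c IH]; first by rewrite !horner0 subrr; exact: low_0.
rewrite !hornerE opprD addrACA subrr addr0.
have -> : F.[p] * p - F.[q] * q = F.[p] * (p - q) + (F.[p] - F.[q]) * q by ring.
by apply: lowD; [exact: lowMl | exact: lowMr].
Qed.

End WeightedNorm.

(** * Analytic germs as coherent sequences of polynomials *)

Section Expansions.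
Variables (R : realType) (N : nat).
Local Notation C := (cplx R).
Local Notation V := (cspace R N).
Implicit Types (a x : V) (f g : V -> C) (r M rho : R).

Lemma pevalD x : {morph @peval R N x : p q / p + q}. Proof. exact: mevalD. Qed.
Lemma pevalB x : {morph @peval R N x : p q / p - q}. Proof. exact: mevalB. Qed.
Lemma pevalM x : {morph @peval R N x : p q / p * q}. Proof. exact: mevalM. Qed.

Lemma wn_le r (p q : cpoly R N) : 0 <= r ->
  (forall m, nm (mcoeff m p) <= nm (mcoeff m q)) -> wn r p <= wn r q.
Proof.
move=> r0 pq; have pqs : {subset msupp p <= msupp q}.
  move=> m; rewrite !mcoeff_msupp -!nm_gt0 => p0.
  exact: lt_le_trans p0 (pq m).
rewrite (wnE r (msupp_uniq q) pqs); apply: ler_sum => m _.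
by rewrite ler_wpM2r ?exprn_ge0.
Qed.

Definition trunc (c : multinom N -> C) d : cpoly R N :=
  \sum_(m : bmultinom N d) c m *: mpolyX _ m.

Lemma mcoeff_trunc c d m :
  mcoeff m (trunc c d) = if (mdeg m < d)%N then c m else 0.
Proof.
case: ifP => md; first exact: mcoeff_mpoly.
rewrite /trunc raddf_sum big1 //= => k _; rewrite mcoeffZ mcoeffX.
by case: eqP => [km|]; rewrite ?mulr0 //; have := bmdeg k; rewrite km md.
Qed.

Lemma wn_trunc r c d :
  wn r (trunc c d) = \sum_(m : bmultinom N d) nm (c m) * r ^+ mdeg m.
Proof.
rewrite (@wnE _ _ r _ [seq bmnm m | m <- enum {: bmultinom N d}]).
- by rewrite big_map big_enum; apply: eq_bigr => m _; rewrite mcoeff_trunc bmdeg.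
- by rewrite map_inj_uniq ?enum_uniq //; exact: val_inj.
move=> m; rewrite mcoeff_msupp mcoeff_trunc; case: ifP => [md _|]; last by rewrite eqxx.
by apply/mapP; exists (BMultinom md) => //; rewrite mem_enum.
Qed.

Lemma low_trunc c d e : (d <= e)%N -> low d (trunc c e - trunc c d).
Proof.
move=> de m md; rewrite mcoeffB !mcoeff_trunc md (leq_trans md de).
by rewrite subrr.
Qed.

Lemma wn_truncB r c d e : 0 <= r -> (d <= e)%N ->
  wn r (trunc c e - trunc c d) <= wn r (trunc c e).
Proof.
move=> r0 de; apply: wn_le => // m; rewrite mcoeffB !mcoeff_trunc.
case: ifP => me; case: ifP => md; rewrite ?subrr ?subr0 ?nm0 ?nm_ge0 //.
by move: md me => /leq_trans /(_ de) ->.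
Qed.

Lemma peval_trunc x c d :
  peval x (trunc c d) = \sum_(m : bmultinom N d) c m * monomial m x.
Proof.
rewrite /peval /trunc raddf_sum; apply: eq_bigr => m _ /=.
by rewrite mevalZ mevalX.
Qed.

Lemma trunc_mono r c d e : 0 <= r -> (d <= e)%N ->
  wn r (trunc c d) <= wn r (trunc c e).
Proof.
move=> r0 de; apply: wn_le => // m; rewrite !mcoeff_trunc.
by case: ifP => [/leq_trans ->|_] //; rewrite nm0 nm_ge0.
Qed.

Lemma sum_bmultinom_mono (F : multinom N -> R) d e : (forall m, 0 <= F m) ->
  (d <= e)%N -> \sum_(m : bmultinom N d) F m <= \sum_(m : bmultinom N e) F m.
Proof.
move=> F0 /(trunc_mono (fun m => ofR (F m)) ler01).
rewrite !wn_trunc => h; apply: le_trans (le_trans _ h) _; apply: ler_sum => m _;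
  by rewrite expr1n mulr1 nm_ofR ger0_norm.
Qed.

(** The polynomials [p d] agree with the Taylor series of [f] at [a] in degrees
    below [d] but need not be truncations of it: this makes sums, products and
    iteration of polynomial maps act termwise. *)
Definition series_at a f (p : nat -> cpoly R N) r M :=
  [/\ 0 < r, forall d, low d (p d.+1 - p d), forall d, wn r (p d) <= M &
      forall d rho x, 0 <= rho <= r -> (forall i, nm (x 0 i - a 0 i) <= rho) ->
        nm (f x - peval (x - a) (p d)) <= M * (rho / r) ^+ d].

Lemma series_ge0 a f p r M : series_at a f p r M -> 0 <= M.
Proof. by case=> r0 _ /(_ 0%N) h _; apply: le_trans h; apply: wn_ge0; exact: ltW. Qed.

Lemma bounded_partial_sums (v : nat -> R) : (forall d, 0 <= v d) ->
  (forall d e, (d <= e)%N -> v d <= v e) -> cvgn (fun d => ofR (v d)) ->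
  exists M, forall d, v d <= M.
Proof.
move=> v0 vm /cvg_ex[l /cvg_cplxP /(_ _ ltr01) [K KP]].
exists (nm l + 1) => d; apply: le_trans (vm _ (d + K)%N (leq_addr _ _)) _.
have := KP _ (leq_addl d K); have := nm_le_dist (ofR (v (d + K)%N)) l.
by rewrite nm_ofR ger0_norm //; lra.
Qed.

Lemma cvg_bounded_sums (v : nat -> R) M : (forall d, v d <= M) ->
  (forall d e, (d <= e)%N -> v d <= v e) -> cvgn (fun d => ofR (v d)).
Proof.
move=> vM vm; have : cvgn v.
  by apply: nondecreasing_is_cvgn; [exact: vm | exists M => _ [d _ <-]].
move=> /cvg_ex[l /cvgrPdist_lt vl].
apply/cvg_ex; exists (ofR l); apply/cvg_cplxP => e /vl[K _ KP].
by exists K => d /KP; rewrite -rmorphB nm_ofR distrC.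
Qed.

Lemma expr_lt_eps (q e : R) : 0 <= q < 1 -> 0 < e -> exists K, q ^+ K < e.
Proof.
move=> /andP[q0 q1] e0; have /cvgrPdist_lt /(_ _ e0) [K _ KP] : q ^+ n @[n --> \oo] --> 0.
  by apply: cvg_expr; rewrite ger0_norm.
by exists K; have := KP K (leqnn K); rewrite /= sub0r normrN ger0_norm ?exprn_ge0.
Qed.

Lemma le_geometric0 (x M q : R) : 0 <= q < 1 -> (forall d, x <= M * q ^+ d) -> x <= 0.
Proof.
move=> q01 h; rewrite leNgt; apply/negP => x0.
have M1 : 0 < `|M| + 1 by apply: ltr_wpDl.
have [K qK] := expr_lt_eps q01 (divr_gt0 x0 M1).
have := h K; move: qK; rewrite ltr_pdivlMr // => h1 h2.
have := ler_norm M; have : 0 <= q ^+ K by case/andP: q01 => q0 _; exact: exprn_ge0.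
by nra.
Qed.

Lemma sum_abs_monomials (c : multinom N -> C) (y : V) d :
  \sum_(m : bmultinom N d) `|c m * monomial m y| =
  ofR (\sum_(m : bmultinom N d) nm (c m) * \prod_i nm (y 0 i) ^+ m i).
Proof.
rewrite rmorph_sum; apply: eq_bigr => m _; rewrite nmE nmM nm_prod.
by congr (ofR (_ * _)); apply: eq_bigr => i _; rewrite nmX.
Qed.

Lemma prod_le_pow (y : V) rho (m : multinom N) : (forall i, nm (y 0 i) <= rho) ->
  \prod_i nm (y 0 i) ^+ m i <= rho ^+ mdeg m.
Proof.
move=> yr; rewrite mdegE -prodrXr; apply: ler_prod => i _.
by rewrite exprn_ge0 ?nm_ge0 //= lerXn2r ?nnegrE ?nm_ge0 // (le_trans (nm_ge0 (y 0 i))).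
Qed.

(** The coefficients are bounded by evaluating the absolutely convergent series at
    the corner of a small polydisc; the tail of degree at least [d] is then dominated
    by a geometric factor. *)
Lemma analytic_trunc a f : analytic_at a f ->
  exists c r M, series_at a f (trunc c) r M.
Proof.
case=> c /near_cspaceP[e e0 h]; pose r := e / 2.
have r0 : 0 < r by rewrite divr_gt0.
have re : r < e by rewrite /r; lra.
have inb x rho : rho <= r -> (forall i, nm (x 0 i - a 0 i) <= rho) ->
    forall i, nm (x 0 i - a 0 i) < e.
  by move=> rr xr i; apply: le_lt_trans (xr i) (le_lt_trans rr re).
have [M MP] : exists M, forall d, wn r (trunc c d) <= M.
  apply: bounded_partial_sums => [d|d d'|]; [exact/wn_ge0/ltW|exact/trunc_mono/ltW|].
  have [|+ _] := h (a + const_mx (ofR r)).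
    move=> i; rewrite !mxE addrAC subrr add0r nm_ofR ger0_norm ?(ltW r0) //.
  rewrite (_ : (fun d => _) = fun d => ofR (wn r (trunc c d))) //.
  apply/funext => d; rewrite sum_abs_monomials wn_trunc.
  congr (ofR _); apply: eq_bigr => m _; congr (_ * _).
  rewrite mdegE -prodrXr; apply: eq_bigr => i _.
  by rewrite !mxE addrAC subrr add0r nm_ofR ger0_norm ?(ltW r0).
exists c, r, M; split=> // [d|d rho x /andP[rho0 rr] xr].
  exact: low_trunc.
have [_ /cvg_cplxP fx] := h _ (inb _ _ rr xr).
apply/ler_addgt0Pr => d0 d0_gt0; have [K KP] := fx _ d0_gt0.
pose e' := maxn d K; have de : (d <= e')%N by rewrite leq_maxl.
apply: le_trans (nm_tri _ (peval (x - a) (trunc c e')) _) _.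
rewrite [leLHS]addrC; apply: lerD; last first.
  by apply: ltW; rewrite nmBC peval_trunc; apply: KP; rewrite leq_maxr.
rewrite -pevalB; apply: le_trans (@nm_peval _ _ rho _ _ _) _.
  by move=> i; rewrite !mxE.
apply: le_trans (wn_low _ r0 (low_trunc c de)) _; first by rewrite rho0.
rewrite mulrC ler_wpM2r //; first by apply/exprn_ge0/divr_ge0 => //; exact: ltW.
exact: le_trans (wn_truncB c (ltW r0) de) (MP _).
Qed.

Lemma analytic_series a f : analytic_at a f -> exists p r M, series_at a f p r M.
Proof. by move=> /analytic_trunc[c [r [M S]]]; exists (trunc c), r, M. Qed.

(** By coherence, the coefficient of degree [k] is already the final one in
    [p k.+1]; the rest of [p d] has order at least [d] and a bounded norm, so it is
    negligible. *)
Lemma series_analytic a f p r M : series_at a f p r M -> analytic_at a f.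
Proof.
move=> S; have M0 := series_ge0 S; case: S => r0 pl pM pf.
pose c m := mcoeff m (p (mdeg m).+1).
have cE m d : (mdeg m < d)%N -> mcoeff m (p d) = c m.
  move=> md; apply/eqP; rewrite /c -subr_eq0 -mcoeffB.
  by rewrite (low_telescope pl md).
have tM d : wn r (trunc c d) <= M.
  apply: le_trans (pM d); apply: wn_le; first exact: ltW.
  by move=> m; rewrite mcoeff_trunc; case: ifP => [/cE ->//|_]; rewrite nm0 nm_ge0.
have lt d : low d (p d - trunc c d).
  by move=> m md; rewrite mcoeffB mcoeff_trunc md cE // subrr.
have ltM d : wn r (p d - trunc c d) <= M.
  apply: le_trans (pM d); apply: wn_le; first exact: ltW.
  move=> m; rewrite mcoeffB mcoeff_trunc; case: ifP => md.
    by rewrite cE // subrr nm0 nm_ge0.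
  by rewrite subr0.
exists c; apply/near_cspaceP; exists (r / 2); first by rewrite divr_gt0.
move=> x xr; pose rho := r / 2.
have rho0 : 0 <= rho <= r by rewrite /rho; apply/andP; split; lra.
have xrho i : nm ((x - a) 0 i) <= rho by rewrite !mxE; exact: ltW.
split.
  rewrite (_ : (fun d => _) = fun d => ofR (\sum_(m : bmultinom N d)
      nm (c m) * \prod_i nm ((x - a) 0 i) ^+ m i)); last first.
    by apply/funext => d; exact: sum_abs_monomials.
  apply: (@cvg_bounded_sums _ M) => [d|d e de].
    apply: le_trans (tM d); rewrite wn_trunc; apply: ler_sum => m _.
    rewrite ler_wpM2l ?nm_ge0 //; apply: prod_le_pow => i.
    by apply: le_trans (xrho i) _; case/andP: rho0.
  by apply: (sum_bmultinom_mono (F := fun m => nm (c m) * \prod_i nm ((x - a) 0 i) ^+ m i)) =>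
    // m; rewrite mulr_ge0 ?nm_ge0 // prodr_ge0 // => i _; rewrite exprn_ge0 ?nm_ge0.
apply/cvg_cplxP => e e0.
have M1 : 0 < 2 * M + 1 by lra.
have q01 : 0 <= (2^-1 : R) < 1 by apply/andP; split; lra.
have rhoq : rho / r = 2^-1 by rewrite /rho mulrAC mulfV ?mul1r // gt_eqF.
have [K qK] := expr_lt_eps q01 (divr_gt0 e0 M1).
exists K => d Kd; rewrite -peval_trunc nmBC.
apply: le_lt_trans (nm_tri _ (peval (x - a) (p d)) _) _.
have h1 := pf d rho x rho0 (fun i => ltW (xr i)).
have h2 : nm (peval (x - a) (p d) - peval (x - a) (trunc c d)) <= M * (rho / r) ^+ d.
  rewrite -pevalB; apply: le_trans (nm_peval _ xrho) _.
  apply: le_trans (wn_low rho0 r0 (lt d)) _.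
  by rewrite mulrC ler_wpM2r // rhoq exprn_ge0; case/andP: q01.
rewrite rhoq in h1 h2.
have dK : 2^-1 ^+ d <= 2^-1 ^+ K :> R by rewrite ler_wiXn2l //; case/andP: q01 => // _ /ltW.
move: qK; rewrite ltr_pdivlMr // => qK.
have : 0 <= 2^-1 ^+ d :> R by rewrite exprn_ge0 //; case/andP: q01.
by nra.
Qed.

Lemma series_shrink a f p r M s M' : series_at a f p r M -> 0 < s <= r -> M <= M' ->
  series_at a f p s M'.
Proof.
move=> S /andP[s0 sr] MM; have M0 := series_ge0 S; case: S => r0 pl pM pf.
split=> // [d|d rho x /andP[rho0 rs] xr].
  by apply: le_trans (le_trans (pM d) MM); rewrite wn_mono // ltW.
apply: le_trans (pf d rho x _ xr) _; first by rewrite rho0 (le_trans rs).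
apply: ler_pM => //; first by rewrite exprn_ge0 // divr_ge0 // ltW.
rewrite lerXn2r ?nnegrE ?divr_ge0 ?(ltW s0) ?(ltW r0) //.
by rewrite ler_wpM2l // lef_pV2.
Qed.

Lemma analytic_eq a f g : analytic_at a f -> germ_eq a f g -> analytic_at a g.
Proof.
case=> c h fg; exists c; move: h fg; rewrite /germ_eq; apply: filterS2.
by move=> x [h1 h2] <-.
Qed.

Lemma analytic_shifted_poly a (q : cpoly R N) : analytic_at a (fun x => peval (x - a) q).
Proof.
apply: (@series_analytic _ _ (fun=> q) 1 (wn 1 q)); split=> // [d|d rho x /andP[rho0 _] _].
  by rewrite subrr; exact: low_0.
by rewrite subrr nm0 mulr_ge0 ?wn_ge0 // exprn_ge0 // divr_ge0.
Qed.

Lemma analytic_const a (c : C) : analytic_at a (fun=> c).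
Proof.
have := analytic_shifted_poly a (mpolyC N c); congr (analytic_at a _).
by apply/funext => x; exact: mevalC.
Qed.

Lemma analyticD a f g : analytic_at a f -> analytic_at a g ->
  analytic_at a (fun x => f x + g x).
Proof.
move=> /analytic_series[p [r [M Sf]]] /analytic_series[q [s [L Sg]]].
have [M0 L0] := (series_ge0 Sf, series_ge0 Sg).
have [r0 s0] : 0 < r /\ 0 < s by case: Sf; case: Sg.
pose t := Num.min r s; have t0 : 0 < t by rewrite lt_min r0.
have := series_shrink Sf (s := t) (M' := M); rewrite t0 ge_min lexx => /(_ isT (lexx _)).
move=> [_ pl pM pf].
have := series_shrink Sg (s := t) (M' := L); rewrite t0 ge_min lexx orbT.
move=> /(_ isT (lexx _)) [_ ql qM qf].
apply: (@series_analytic _ _ (fun d => p d + q d) t (M + L)); split=> // [d|d|d rho x rr xr].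
- by rewrite opprD addrACA; exact: lowD.
- by apply: le_trans (wnD _ _ (ltW t0)) (lerD (pM d) (qM d)).
rewrite pevalD opprD addrACA mulrDl; apply: le_trans (nmD _ _) _.
by apply: lerD; [exact: pf | exact: qf].
Qed.

(** The Cauchy product: in degrees below [d], the product [p d * q d] depends only on
    the terms of its factors of degree below [d]. *)
Lemma analyticM a f g : analytic_at a f -> analytic_at a g ->
  analytic_at a (fun x => f x * g x).
Proof.
move=> /analytic_series[p [r [M Sf]]] /analytic_series[q [s [L Sg]]].
have [M0 L0] := (series_ge0 Sf, series_ge0 Sg).
have [r0 s0] : 0 < r /\ 0 < s by case: Sf; case: Sg.
pose t := Num.min r s; have t0 : 0 < t by rewrite lt_min r0.
have := series_shrink Sf (s := t) (M' := M); rewrite t0 ge_min lexx => /(_ isT (lexx _)).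
move=> [_ pl pM pf].
have := series_shrink Sg (s := t) (M' := L); rewrite t0 ge_min lexx orbT.
move=> /(_ isT (lexx _)) [_ ql qM qf].
apply: (@series_analytic _ _ (fun d => p d * q d) t (3 * (M * L))).
have ML0 : 0 <= M * L by rewrite mulr_ge0.
have pqM d : wn t (p d * q d) <= M * L.
  by apply: le_trans (wnM _ _ (ltW t0)) _; rewrite ler_pM ?wn_ge0 ?(ltW t0).
split=> // [d|d|d rho x rr xr].
- have -> : p d.+1 * q d.+1 - p d * q d =
      (p d.+1 - p d) * q d.+1 + p d * (q d.+1 - q d) by ring.
  by apply: lowD; [exact: lowMr | exact: lowMl].
- by apply: le_trans (pqM d) _; lra.
rewrite pevalM.
set P := peval _ (p d); set Q := peval _ (q d).
have -> : f x * g x - P * Q = (f x - P) * g x + P * (g x - Q) by ring.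
have h1 := pf d rho x rr xr; have h2 := qf d rho x rr xr.
have gL : nm (g x) <= 2 * L.
  have := qf 0%N rho x rr xr; rewrite expr0 mulr1 => h.
  apply: le_trans (nm_le_dist _ (peval (x - a) (q 0%N))) _.
  suff h' : nm (peval (x - a) (q 0%N)) <= L by move: h h'; set u := nm _; set v := nm _; lra.
  apply: le_trans (qM 0%N); apply: nm_peval => i; rewrite !mxE.
  by apply: le_trans (xr i) _; case/andP: rr.
have PM : nm P <= M.
  apply: le_trans (pM d); apply: nm_peval => i; rewrite !mxE.
  by apply: le_trans (xr i) _; case/andP: rr.
apply: le_trans (nmD _ _) _; rewrite !nmM.
have -> : 3 * (M * L) * (rho / t) ^+ d =
    M * (rho / t) ^+ d * (2 * L) + M * (L * (rho / t) ^+ d) by ring.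
by apply: lerD; apply: ler_pM; rewrite ?nm_ge0.
Qed.

Lemma analytic_sum a I (s : seq I) (F : I -> V -> C) :
  (forall i, analytic_at a (F i)) -> analytic_at a (fun x => \sum_(i <- s) F i x).
Proof.
move=> Fa; elim: s => [|i s IH].
  by under eq_fun do rewrite big_nil; exact: analytic_const.
have -> : (fun x => \sum_(j <- i :: s) F j x) = (fun x => F i x + \sum_(j <- s) F j x).
  by apply/funext => x; rewrite big_cons.
exact: analyticD (Fa i) IH.
Qed.

Lemma analytic_prod a I (s : seq I) (F : I -> V -> C) :
  (forall i, analytic_at a (F i)) -> analytic_at a (fun x => \prod_(i <- s) F i x).
Proof.
move=> Fa; elim: s => [|i s IH].
  by under eq_fun do rewrite big_nil; exact: analytic_const.
have -> : (fun x => \prod_(j <- i :: s) F j x) = (fun x => F i x * \prod_(j <- s) F j x).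
  by apply/funext => x; rewrite big_cons.
exact: analyticM (Fa i) IH.
Qed.

Lemma analyticX a f k : analytic_at a f -> analytic_at a (fun x => f x ^+ k).
Proof.
move=> fa; elim: k => [|k IH].
  by under eq_fun do rewrite expr0; exact: analytic_const.
have -> : (fun x => f x ^+ k.+1) = (fun x => f x * f x ^+ k).
  by apply/funext => x; rewrite exprS.
exact: analyticM fa IH.
Qed.

Lemma analytic_meval a n (f : 'I_n -> V -> C) (q : cpoly R n) :
  (forall i, analytic_at a (f i)) -> analytic_at a (fun x => meval (fun i => f i x) q).
Proof.
move=> fa; under eq_fun do rewrite mevalE.
apply: analytic_sum => m; apply: analyticM; first exact: analytic_const.
by apply: analytic_prod => i; exact: analyticX.
Qed.

Lemma analytic_peval a (q : cpoly R N) : analytic_at a (fun x => peval x q).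
Proof.
apply: (@analytic_meval a N (fun i (x : V) => x 0 i)) => i.
have := analyticD (analytic_shifted_poly a (mpolyX _ (mnm1 i))) (analytic_const a (a 0 i)).
congr (analytic_at a _); apply/funext => x.
by rewrite /peval mevalXU !mxE subrK.
Qed.

End Expansions.

(** * Simple roots depend analytically on the parameters *)

Section ImplicitFunction.
Variables (R : realType) (N : nat).
Local Notation C := (cplx R).
Local Notation V := (cspace R N).

HB.instance Definition _ (x : V) :=
  GRing.RMorphism.copy (@peval R N x) (meval (fun i => x 0 i)).

Definition shift_poly (a : V) : cpoly R N -> cpoly R N :=
  comp_mpoly [tuple mpolyX _ (mnm1 i) + mpolyC N (a 0 i) | i < N].

HB.instance Definition _ (a : V) := GRing.RMorphism.copy (shift_poly a)
  (comp_mpoly [tuple mpolyX _ (mnm1 i) + mpolyC N (a 0 i) | i < N]).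

Lemma peval_shift (a x : V) p : peval x (shift_poly a p) = peval (x + a) p.
Proof.
rewrite /peval /shift_poly comp_mpoly_meval; apply: meval_eq => i.
by rewrite tnth_mktuple mevalD mevalXU mevalC mxE.
Qed.

Lemma pevalC (x : V) (c : C) : peval x (mpolyC N c) = c.
Proof. exact: mevalC. Qed.

Lemma peval0 (p : cpoly R N) : peval 0 p = mcoeff mnm0 p.
Proof.
pose q := p - mpolyC N (mcoeff mnm0 p).
have lq : low 1 q.
  by apply: low1E; rewrite mcoeffB mcoeffC eqxx mulr1 subrr.
have -> : p = q + mpolyC N (mcoeff mnm0 p) by rewrite subrK.
rewrite rmorphD /= pevalC; set c := mcoeff _ _.
rewrite mcoeffD (lq mnm0) ?mdeg0 // mcoeffC eqxx mulr1 add0r.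
suff -> : peval 0 q = 0 by rewrite add0r.
apply/eqP; rewrite -nm_eq0 eq_le nm_ge0 andbT.
apply: le_trans (nm_peval (r := 0) _ _) _; first by move=> i; rewrite mxE nm0.
apply: le_trans (wn_low (r := 1) _ ltr01 lq) _; first by rewrite lexx ler01.
by rewrite mul0r expr1 mul0r.
Qed.

Lemma horner_lipschitz (q : {poly C}) (B : R) : 0 <= B ->
  exists2 L, 0 <= L & forall a b, nm a <= B -> nm b <= B ->
    nm (q.[a] - q.[b]) <= L * nm (a - b).
Proof.
move=> B0; elim/poly_ind: q => [|q c [L L0 IH]].
  by exists 0 => // a b _ _; rewrite !horner0 subrr nm0 mul0r.
exists (B * L + nm q.[0] + L * B).
  by rewrite !addr_ge0 ?mulr_ge0 ?nm_ge0.
move=> a b aB bB; rewrite !hornerE.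
have -> : q.[a] * a + c - (q.[b] * b + c) = a * (q.[a] - q.[b]) + q.[b] * (a - b).
  by ring.
apply: le_trans (nmD _ _) _; rewrite !nmM -addrA mulrDl -mulrA.
apply: lerD; first by rewrite ler_pM ?nm_ge0 ?IH.
rewrite ler_wpM2r ?nm_ge0 //; apply: le_trans (nm_le_dist _ q.[0]) _.
rewrite lerD2l; apply: le_trans (IH _ _ bB _) _; first by rewrite nm0.
by rewrite subr0 ler_wpM2l.
Qed.

Lemma wn_horner (D : {poly cpoly R N}) (r : R) (w : cpoly R N) :
  0 <= r <= 1 -> wn r w <= 1 -> wn r D.[w] <= \sum_(j < size D) wn 1 D`_j.
Proof.
move=> r01 w1; have r0 : 0 <= r by case/andP: r01.
rewrite horner_coef; apply: le_trans (wn_sum _ _ _ r0) _.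
apply: ler_sum => j _; apply: le_trans (wnM _ _ r0) _.
rewrite -[leRHS]mulr1; apply: ler_pM; rewrite ?wn_ge0 ?wn_mono //.
elim: (nat_of_ord j) => [|k IH]; first by rewrite expr0 -mpolyC1 wnC nm1.
rewrite exprS; apply: le_trans (wnM _ _ r0) _.
by rewrite -[leRHS]mulr1; apply: ler_pM; rewrite ?wn_ge0.
Qed.

Section FixedPoint.
Variable F : {poly cpoly R N}.
Hypothesis F0 : mcoeff mnm0 F`_0 = 0.
Hypothesis F1 : mcoeff mnm0 F`_1 = 0.

Let D := drop_poly 2 F.

Lemma horner_quadratic w : F.[w] = F`_0 + F`_1 * w + D.[w] * w ^+ 2.
Proof.
rewrite -{1}(poly_take_drop 2 F) hornerD hornerM hornerXn; congr (_ + _).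
rewrite (horner_coef_wide _ (size_take_poly 2 F)) !big_ord_recl big_ord0 /=.
by rewrite !coef_take_poly /= expr0 mulr1 expr1 addr0.
Qed.

Lemma low_contraction d a b : low 1 a -> low 1 b -> low d (a - b) ->
  low d.+1 (F.[a] - F.[b]).
Proof.
move=> la lb lab; rewrite !horner_quadratic.
have -> : F`_0 + F`_1 * a + D.[a] * a ^+ 2 - (F`_0 + F`_1 * b + D.[b] * b ^+ 2)
  = F`_1 * (a - b) + ((D.[a] - D.[b]) * (a * a) + D.[b] * ((a - b) * (a + b))).
  by ring.
apply: lowD; first by rewrite -add1n; apply: lowM => //; exact: low1E.
rewrite -addn1; apply: lowD.
  by apply: lowM; [exact: low_horner_sub | exact: lowMr].
by apply: lowMl; apply: lowM => //; exact: lowD.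
Qed.

Let Y d : cpoly R N := iter d (fun w => F.[w]) 0.

Lemma low1_iter d : low 1 (Y d).
Proof.
elim: d => [|d IH] /=; first exact: low_0.
rewrite -/(Y d) horner_quadratic; apply: lowD; last first.
  by apply: lowMl; rewrite expr2; exact: lowMr.
by apply: lowD; [exact: low1E | exact: lowMl].
Qed.

Lemma low_iter d : low d (Y d.+1 - Y d).
Proof.
elim: d => [//|d IH].
exact: (low_contraction (low1_iter d.+1) (low1_iter d) IH).
Qed.

Lemma wn_iter : exists r s : R, [/\ 0 < r, 0 < s <= 1 & forall d, wn r (Y d) <= s].
Proof.
pose K : R := 1 + wn 1 F`_0 + wn 1 F`_1 + \sum_(j < size D) wn 1 D`_j.
have K0 := wn_ge0 F`_0 ler01; have K1 := wn_ge0 F`_1 ler01.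
have K2 : 0 <= \sum_(j < size D) wn 1 D`_j.
  by apply: sumr_ge0 => j _; exact: wn_ge0.
have KK : 1 <= K by rewrite /K; lra.
pose s := (4 * K)^-1; pose r := s * s.
have Kp : 0 < 4 * K by lra.
have s0 : 0 < s by rewrite invr_gt0.
have sK : s * K = 4^-1.
  by rewrite /s invfM -mulrA mulVf ?mulr1 // gt_eqF //; lra.
have s1 : s <= 1 by move: sK s0 KK; clear; nra.
have r0 : 0 < r by rewrite mulr_gt0.
have r1 : r <= 1 by rewrite /r; move: s0 s1; clear; nra.
exists r, s; split; rewrite ?s0 //; elim=> [|d IH]; first by rewrite wn0 ltW.
rewrite /= -/(Y d) horner_quadratic.
have lin (p : cpoly R N) : low 1 p -> wn r p <= r * wn 1 p.
  move=> lp; apply: le_trans (wn_low (r := 1) _ ltr01 lp) _.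
    by rewrite (ltW r0).
  by rewrite divr1 expr1.
have h0 := lin _ (low1E F0); have h1 := lin _ (low1E F1).
have h2 : wn r D.[Y d] <= K.
  apply: le_trans (wn_horner _ _ _) _; rewrite ?(ltW r0) //.
    exact: le_trans IH s1.
  by rewrite /K; lra.
have y0 := wn_ge0 (Y d) (ltW r0).
have rK : r * K = s / 4 by rewrite /r -mulrA sK.
have b0 : wn r F`_0 <= s / 4.
  by apply: le_trans h0 _; rewrite -rK ler_wpM2l ?(ltW r0) // /K; lra.
have b1 : wn r (F`_1 * Y d) <= s / 4.
  apply: le_trans (wnM _ _ (ltW r0)) _.
  rewrite -[leRHS]mulr1; apply: ler_pM; rewrite ?wn_ge0 ?(ltW r0) //.
    by apply: le_trans h1 _; rewrite -rK ler_wpM2l ?(ltW r0) // /K; lra.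
  exact: le_trans IH s1.
have b2 : wn r (D.[Y d] * Y d ^+ 2) <= s / 4.
  apply: le_trans (wnM _ _ (ltW r0)) _.
  have -> : s / 4 = K * (s * s) by rewrite -sK; ring.
  apply: ler_pM; rewrite ?wn_ge0 ?(ltW r0) // expr2.
  by apply: le_trans (wnM _ _ (ltW r0)) _; rewrite ler_pM.
apply: le_trans (wnD _ _ (ltW r0)) _.
have := wnD F`_0 (F`_1 * Y d) (ltW r0).
by move: b0 b1 b2; set u := wn _ _; set v := wn _ _; set z := wn _ _; set t := wn _ _; lra.
Qed.

(** An equation [y = F x y] whose right-hand side has no constant term and no term
    proportional to [y] is solved by iteration: the iterates stabilise degree by
    degree, and their weighted norms stay bounded because the right-hand side is
    contracting at small weights. *)
Lemma fixed_point_series : exists g p r M,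
  [/\ series_at (0 : V) g p r M, g 0 = 0 &
      \forall x \near (0 : V), (map_poly (peval x) F).[g x] = g x].
Proof.
have [r [s [r0 /andP[s0 s1] Ys]]] := wn_iter.
have Ydiff d e : wn r (Y e - Y d) <= 2 * s.
  by apply: le_trans (wnD _ _ (ltW r0)) _; rewrite wnN; have := Ys d; have := Ys e; lra.
have bound d e rho (x : V) : (d <= e)%N -> 0 <= rho <= r ->
    (forall i, nm (x 0 i) <= rho) ->
    nm (peval x (Y e) - peval x (Y d)) <= 2 * s * (rho / r) ^+ d.
  move=> de rr xr; rewrite -rmorphB; apply: le_trans (nm_peval _ xr) _.
  apply: le_trans (wn_low rr r0 (low_telescope low_iter de)) _.
  by rewrite mulrC ler_wpM2r // exprn_ge0 // divr_ge0 ?(ltW r0) //; case/andP: rr.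
have rho2 : r / 2 / r = 2^-1 by rewrite mulrAC mulfV ?mul1r // gt_eqF.
have r2 : 0 <= r / 2 <= r by apply/andP; split; lra.
have : forall x : V, exists l : C, (forall i, nm (x 0 i) <= r / 2) ->
    forall d, nm (l - peval x (Y d)) <= 4 * (2 * s) * 2^-1 ^+ d.
  move=> x; have [xr|xr] := pselect (forall i, nm (x 0 i) <= r / 2); last by exists 0.
  have [|l lP] := @geometric_limit R (fun d => peval x (Y d)) (2 * s).
    by move=> d; rewrite -rho2; apply: bound.
  by exists l.
move=> /choice[g gP].
have S : series_at 0 g Y (r / 2) (2 * s).
  split=> [|d|d|d rho x /andP[rho0 rr] xr]; first by rewrite divr_gt0.
  - exact: low_iter.
  - apply: le_trans (wn_mono _ _) (le_trans (Ys d) _); last by lra.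
    by [].
  have xr' i : nm (x 0 i) <= rho by have := xr i; rewrite mxE subr0.
  have rho_r : rho <= r by apply: le_trans rr _; case/andP: r2.
  apply: (@le_trans _ _ (2 * s * (rho / r) ^+ d)); last first.
    rewrite ler_wpM2l //; first by lra.
    have r20 : 0 < r / 2 by rewrite divr_gt0.
    have rV : r^-1 <= (r / 2)^-1 by rewrite lef_pV2 ?posrE //; lra.
    by rewrite lerXn2r ?nnegrE ?ler_wpM2l // divr_ge0 // ltW.
  apply/ler_addgt0Pr => e e0.
  have q01 : 0 <= (2^-1 : R) < 1 by apply/andP; split; lra.
  have s8 : 0 < 4 * (2 * s) by lra.
  have [K KP] := expr_lt_eps q01 (divr_gt0 e0 s8).
  move: KP; rewrite ltr_pdivlMr // mulrC => KP.
  pose k := maxn d K.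
  rewrite subr0; apply: le_trans (nm_tri _ (peval x (Y k)) _) _.
  rewrite [leLHS]addrC; apply: lerD.
    by apply: bound; rewrite ?leq_maxl ?rho0.
  apply: le_trans (gP x (fun i => le_trans (xr' i) rr) k) _.
  apply: le_trans _ (ltW KP); rewrite ler_wpM2l ?(ltW s8) // ler_wiXn2l ?leq_maxr //.
  by case/andP: q01 => _ /ltW.
exists g, Y, (r / 2), (2 * s); split=> //.
  have [r20 _ _ pS] := S.
  have : nm (g 0 - peval (0 - 0) (Y 1)) <= 2 * s * (0 / (r / 2)) ^+ 1.
    by apply: pS; rewrite ?lexx ?(ltW r20) // => i; rewrite mxE subr0 nm0.
  have y1 : mcoeff mnm0 (Y 1) = 0 by apply: (low1_iter 1); rewrite mdeg0.
  rewrite mul0r expr1 mulr0 subr0 peval0 y1 subr0.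
  by move=> h; apply/eqP; rewrite -nm_eq0 eq_le h nm_ge0.
apply/near_cspaceP; exists (r / 2); first by rewrite divr_gt0.
move=> x xr'; have xr i : nm (x 0 i) <= r / 2 by have := xr' i; rewrite mxE subr0 => /ltW.
have gx := gP x xr.
set q := map_poly _ _.
have qY d : q.[peval x (Y d)] = peval x (Y d.+1) by rewrite /q horner_map.
have [L L0 LP] := horner_lipschitz q (B := 1 + 8 * s) ltac:(lra).
apply/eqP; rewrite -subr_eq0 -nm_eq0 eq_le nm_ge0 andbT.
apply: (@le_geometric0 _ _ ((L + 1) * (8 * s)) 2^-1); first by apply/andP; split; lra.
move=> d; have Yd k : nm (peval x (Y k)) <= s.
  apply: le_trans (Ys k); apply: nm_peval => i.
  by apply: le_trans (xr i) _; case/andP: r2.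
have gB : nm (g x) <= 1 + 8 * s.
  have := gx 0%N; rewrite expr0 mulr1 => h.
  by have := nm_le_dist (g x) (peval x (Y 0%N)); have := Yd 0%N; lra.
apply: le_trans (nm_tri _ (q.[peval x (Y d)]) _) _.
have YB : nm (peval x (Y d)) <= 1 + 8 * s by have := Yd d; lra.
have h1 := LP _ _ gB YB.
have h2 := gx d; have h3 := gx d.+1.
rewrite qY in h1 *; rewrite (nmBC (peval _ _)).
have h4 : L * nm (g x - peval x (Y d)) <= L * (4 * (2 * s) * 2^-1 ^+ d) by rewrite ler_wpM2l.
have h5 : 0 <= 2^-1 ^+ d :> R by rewrite exprn_ge0.
have h6 : 2^-1 ^+ d.+1 <= 2^-1 ^+ d :> R by rewrite exprS; lra.
have h7 : s * 2^-1 ^+ d.+1 <= s * 2^-1 ^+ d by rewrite ler_wpM2l // ltW.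
apply: le_trans (lerD h1 h3) _; apply: le_trans (lerD h4 (lexx _)) _.
move: h7; clear -s0; set u := _ ^+ d.+1; set v := _ ^+ d => h7.
have -> : (L + 1) * (8 * s) * v = L * (4 * (2 * s) * v) + 8 * (s * v) by ring.
by rewrite lerD2l; move: h7; lra.
Qed.

End FixedPoint.

(** The implicit function theorem: translated to the origin, the Newton map
    [y - P (x, y) / c] with the fixed slope [c] has no constant term and no term
    proportional to [y]. *)
Lemma simple_root_germ (P : {poly cpoly R N}) (a : V) (y : C) :
  (map_poly (peval a) P).[y] = 0 -> (map_poly (peval a) P)^`().[y] != 0 ->
  exists f, [/\ analytic_at a f, f a = y &
    \forall x \near a, (map_poly (peval x) P).[f x] = 0].
Proof.
move=> Py; set c := _^`().[y] => c0.
pose Q := (map_poly (shift_poly a) P) \Po ('X + (mpolyC N y)%:P).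
pose F := 'X - (mpolyC N c^-1)%:P * Q.
have QE x : map_poly (peval x) Q = map_poly (peval (x + a)) P \Po ('X + y%:P).
  rewrite map_comp_poly rmorphD /= map_polyX map_polyC /= pevalC.
  congr (_ \Po _); rewrite -map_poly_comp /=; apply: eq_map_poly => p /=.
  exact: peval_shift.
have FE x : map_poly (peval x) F = 'X - c^-1%:P * (map_poly (peval (x + a)) P \Po ('X + y%:P)).
  by rewrite rmorphB rmorphM /= map_polyX map_polyC /= pevalC QE.
have coefE k : mcoeff mnm0 F`_k = (map_poly (peval 0) F)`_k by rewrite coef_map /= peval0.
have F0 : mcoeff mnm0 F`_0 = 0.
  rewrite coefE FE add0r -horner_coef0 !hornerE horner_comp !hornerE ?add0r Py.
  by rewrite mulr0 ?subr0 ?oppr0.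
have F1 : mcoeff mnm0 F`_1 = 0.
  rewrite coefE FE add0r.
  have -> (p : {poly C}) : p`_1 = p^`().[0].
    by rewrite horner_coef0 coef_deriv mulr1n.
  rewrite derivB derivX deriv_mulC deriv_comp derivD derivX derivC addr0 mulr1.
  by rewrite !hornerE horner_comp !hornerE ?add0r -/c mulVf // subrr.
have [g [p [r [M [S g0 gF]]]]] := fixed_point_series F0 F1.
exists (fun x => y + g (x - a)); split.
- apply: analyticD; first exact: analytic_const.
  apply: (@series_analytic _ _ _ _ p r M); case: S => r0 pl pM pg.
  split=> // d rho x rr xr; have := pg d rho (x - a) rr.
  by rewrite subr0; apply=> i; rewrite !mxE subr0.
- by rewrite subrr g0 addr0.
move: gF => /near_cspaceP[e e0 h]; apply/near_cspaceP; exists e => // x xe.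
have : forall i, nm ((x - a) 0 i - (0 : V) 0 i) < e by move=> i; rewrite !mxE subr0.
move=> /h; rewrite FE subrK !hornerE horner_comp !hornerE => /eqP.
rewrite subr_eq eq_sym -subr_eq0 addrAC subrr add0r mulf_eq0 invr_eq0 (negPf c0) /=.
by rewrite addrC => /eqP.
Qed.

(** The inverse is the simple root of [q Y - 1]. *)
Lemma analytic_inv (q : cpoly R N) (a : V) : peval a q != 0 ->
  analytic_at a (fun x => (peval x q)^-1).
Proof.
move=> q0; pose P := q%:P * 'X - 1 : {poly cpoly R N}.
have PE x : map_poly (peval x) P = (peval x q)%:P * 'X - 1.
  by rewrite rmorphB rmorphM /= map_polyX map_polyC rmorph1.
have [||f [fa fE fP]] := @simple_root_germ P a (peval a q)^-1.
- by rewrite PE !hornerE mulfV // subrr.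
- by rewrite PE derivB deriv_mulC derivX mulr1 derivC subr0 hornerC.
apply: analytic_eq fa _; move: fP; rewrite /germ_eq; apply: filterS => x.
rewrite PE !hornerE => /eqP; rewrite subr_eq0 => /eqP h.
have q1 : peval x q != 0.
  by apply/eqP => q1; move: h; rewrite q1 mul0r => /eqP; rewrite eq_sym oner_eq0.
by apply: (mulfI q1); rewrite h mulfV.
Qed.

(** * Continuity of analytic functions *)

Definition cont_at (f : V -> C) (a : V) :=
  forall e : R, 0 < e -> \forall x \near a, nm (f x - f a) < e.

Lemma analytic_cont f a : analytic_at a f -> cont_at f a.
Proof.
move=> /analytic_series[p [r [M S]]]; have M0 := series_ge0 S; case: S => r0 _ _ pf.
pose q := p 1%N - mpolyC N (mcoeff mnm0 (p 1%N)).
have lq : low 1 q.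
  by apply: low1E; rewrite mcoeffB mcoeffC eqxx mulr1 subrr.
pose L := M + wn r q.
have L0 : 0 <= L by rewrite addr_ge0 ?wn_ge0 ?(ltW r0).
have fa : f a = mcoeff mnm0 (p 1%N).
  have h : nm (f a - peval (a - a) (p 1%N)) <= M * (0 / r) ^+ 1.
    by apply: pf; rewrite ?lexx ?(ltW r0) // => i; rewrite subrr nm0.
  move: h; rewrite subrr peval0 mul0r expr1 mulr0 => h.
  by apply/eqP; rewrite -subr_eq0 -nm_eq0 eq_le h nm_ge0.
move=> e e0; apply/near_cspaceP; exists (Num.min r (e * r / (L + 1))).
  by rewrite lt_min r0 divr_gt0 ?mulr_gt0 //; lra.
move=> x; set rho := Num.min _ _ => xr.
have rho0 : 0 < rho by rewrite lt_min r0 divr_gt0 ?mulr_gt0 //; lra.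
have rr : 0 <= rho <= r by rewrite ltW //= ge_min lexx.
have h1 := pf 1%N rho x rr (fun i => ltW (xr i)).
have h2 : nm (peval (x - a) q) <= rho / r * wn r q.
  apply: le_trans (nm_peval (r := rho) _ _) _; first by move=> i; rewrite !mxE ltW.
  by apply: le_trans (wn_low rr r0 lq) _; rewrite expr1.
have qE : peval (x - a) q = peval (x - a) (p 1%N) - f a.
  by rewrite rmorphB /= pevalC fa.
rewrite qE in h2; rewrite expr1 in h1.
apply: le_lt_trans (nm_tri _ (peval (x - a) (p 1%N)) _) _.
apply: le_lt_trans (lerD h1 h2) _.
have -> : M * (rho / r) + rho / r * wn r q = rho * L / r by rewrite /L; ring.
rewrite ltr_pdivrMr //.
have : rho <= e * r / (L + 1) by rewrite ge_min lexx orbT.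
rewrite ler_pdivlMr; last by lra.
have : 0 < e * r by rewrite mulr_gt0.
by move: rho0; clear; nra.
Qed.

(** On a smaller box [f] is a uniform limit of polynomials. *)
Lemma analytic_cont_near f a : analytic_at a f ->
  exists2 e : R, 0 < e &
    forall x : V, (forall i, nm (x 0 i - a 0 i) < e) -> cont_at f x.
Proof.
move=> /analytic_series[p [r [M S]]]; have M0 := series_ge0 S; case: S => r0 _ _ pf.
pose rho := r / 2; have rr : 0 <= rho <= r by rewrite /rho; apply/andP; split; lra.
have rhoq : rho / r = 2^-1 by rewrite /rho mulrAC mulfV ?mul1r // gt_eqF.
have q01 : 0 <= (2^-1 : R) < 1 by apply/andP; split; lra.
exists (r / 4) => [|x xr e e0]; first by rewrite divr_gt0.
have M1 : 0 < 3 * M + 1 by lra.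
have [d dP] := expr_lt_eps q01 (divr_gt0 e0 M1).
have tail (y : V) : (forall i, nm (y 0 i - a 0 i) <= rho) ->
    3 * nm (f y - peval (y - a) (p d)) < e.
  move=> yr; have := pf d rho y rr yr; rewrite rhoq.
  move: dP; rewrite ltr_pdivlMr //; have : 0 <= 2^-1 ^+ d :> R by rewrite exprn_ge0.
  by move: M0; set u := _ ^+ d; set v := nm _; clear; nra.
have e3 : 0 < e / 3 by rewrite divr_gt0.
have pc := analytic_cont (analytic_peval x (shift_poly (- a) (p d))) e3.
have [e1 e10 h1] : exists2 e1 : R, 0 < e1 & forall y : V, (forall i, nm (y 0 i - x 0 i) < e1) ->
    nm (peval (y - a) (p d) - peval (x - a) (p d)) < e / 3.
  by have /near_cspaceP[e1 e10 h] := pc; exists e1 => // y /h; rewrite !peval_shift.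
apply/near_cspaceP; exists (Num.min e1 (r / 4)).
  by rewrite lt_min e10 divr_gt0.
move=> y yx; have yx1 i : nm (y 0 i - x 0 i) < e1 by have := yx i; rewrite lt_min => /andP[].
have yr i : nm (y 0 i - a 0 i) <= rho.
  apply: le_trans (nm_tri _ (x 0 i) _) _.
  by have := xr i; have := yx i; rewrite lt_min /rho => /andP[_]; lra.
have xr' i : nm (x 0 i - a 0 i) <= rho by have := xr i; rewrite /rho; lra.
have t1 := tail y yr; have t2 := tail x xr'; have t3 := h1 y yx1.
apply: le_lt_trans (nm_tri _ (peval (y - a) (p d)) _) _.
apply: le_lt_trans (lerD (lexx _) (nm_tri _ (peval (x - a) (p d)) _)) _.
rewrite (nmBC _ (f x)); move: t1 t2 t3.
by set u := nm _; set v := nm _; set w := nm _; lra.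
Qed.

End ImplicitFunction.

(** * Fibres of the equation outside the discriminant locus *)

Section Fibres.
Variables (R : realType) (N : nat).
Local Notation C := (cplx R).
Local Notation V := (cspace R N).
Variable P : {poly cpoly R N}.
Hypothesis P_gt1 : (1 < size P)%N.
Local Notation n := (size P).-1.

Definition fibre (x : V) : {poly C} := map_poly (peval x) P.

Lemma SigmaN (x : V) : ~ Sigma P x ->
  peval x (lead_coef P) != 0 /\ peval x (discriminant P) != 0.
Proof.
by move=> /eqP; rewrite pevalM mulf_eq0 negb_or => /andP[].
Qed.

Lemma size_fibre x : ~ Sigma P x -> size (fibre x) = size P.
Proof. by move=> /SigmaN[lx _]; rewrite size_map_poly_id0. Qed.

(** The resultant of P and P' lies in the ideal they generate, so a multiple root
    over x would make the discriminant vanish at x. *)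
Lemma fibre_simple x y : ~ Sigma P x -> (fibre x).[y] = 0 ->
  (fibre x)^`().[y] != 0.
Proof.
move=> xS Py; have [lx dx] := SigmaN xS; apply/eqP => dPy.
have res0 : peval x (resultant P P^`()) != 0.
  have := congr1 (peval x) (discriminantE (@cpoly_char0 R N) P_gt1).
  rewrite !rmorphM /= => h; apply/eqP => r0.
  by move: h; rewrite r0 mulr0 => /eqP; rewrite mulf_eq0 (negPf lx) (negPf dx).
have dE : map_poly (peval x) P^`() = (fibre x)^`() by rewrite /fibre deriv_map.
have [s2|s_gt2] := leqP (size P) 2.
  have sP : size P = 2 by apply/eqP; rewrite eqn_leq s2.
  have sd : (size (fibre x)^`() <= 1)%N.
    by apply/leq_sizeP => j j1; rewrite coef_deriv nth_default ?mul0rn // size_fibre // sP.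
  move: dPy; rewrite (size1_polyC sd) hornerC coef_deriv mulr1n coef_map /=.
  have -> : P`_1 = lead_coef P by rewrite lead_coefE sP.
  by move/eqP; rewrite (negPf lx).
have sd : (1 < size P^`())%N.
  have [k kE] : exists k, size P = k.+3 by case: (size P) s_gt2 => [|[|[|k]]] // _; exists k.
  rewrite ltnNge; apply/negP => /leq_sizeP /(_ k.+1 isT) /eqP.
  rewrite coef_deriv -mulr_natr mulf_eq0 (negPf (cpoly_char0 R N k.+1)) orbF.
  have -> : P`_k.+2 = lead_coef P by rewrite lead_coefE kE.
  by rewrite lead_coef_eq0 -size_poly_eq0 kE.
have [[u v] /= _ /(congr1 (map_poly (peval x)))] := resultant_in_ideal P_gt1 sd.
rewrite map_polyC rmorphD !rmorphM /= => /(congr1 (fun q => q.[y])).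
rewrite hornerC hornerD !hornerM dE dPy -/(fibre x) Py !mulr0 addr0.
by move/eqP; rewrite (negPf res0).
Qed.

(** A repeated linear factor would divide the derivative. *)
Lemma simple_roots_uniq (c : C) (s : seq C) :
  (forall y, (c *: \prod_(z <- s) ('X - z%:P)).[y] = 0 ->
     (c *: \prod_(z <- s) ('X - z%:P))^`().[y] != 0) -> uniq s.
Proof.
elim: s => //= z s IH; rewrite big_cons scalerAr; set q := c *: _.
have dE y : (('X - z%:P) * q)^`().[y] = q.[y] + (y - z) * q^`().[y].
  by rewrite derivM derivXsubC mul1r hornerD hornerM hornerXsubC.
move=> h; apply/andP; split.
  apply/negP => zs; have qz : q.[z] = 0.
    by rewrite hornerZ (rootP _) ?mulr0 // root_prod_XsubC.
  have := h z; rewrite dE qz subrr mul0r addr0 eqxx hornerM qz mulr0.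
  by move=> /(_ erefl).
apply: IH => y qy; have := h y; rewrite dE qy add0r hornerM qy mulr0.
by move=> /(_ erefl); rewrite mulf_eq0 negb_or => /andP[].
Qed.

Lemma fibre_roots x : ~ Sigma P x -> exists z : 'I_n -> C,
  injective z /\ forall i, (fibre x).[z i] = 0.
Proof.
move=> xS; have [s sE] := closed_field_poly_normal (fibre x).
have s_uniq : uniq s.
  apply: (@simple_roots_uniq (lead_coef (fibre x))) => y.
  by rewrite -sE; exact: fibre_simple.
have ss : size s = n.
  have := size_fibre xS; rewrite {1}sE size_scale ?size_prod_XsubC => [<- //|].
  by rewrite lead_coef_eq0 -size_poly_eq0 size_fibre // -lt0n ltnW.
exists (fun i => s`_i); split=> [i j /eqP|i].
  by rewrite nth_uniq ?ss // => /eqP/val_inj.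
by rewrite sE hornerZ (rootP _) ?mulr0 // root_prod_XsubC mem_nth ?ss.
Qed.

Lemma roots_exhaust x (z : 'I_n -> C) y : ~ Sigma P x -> injective z ->
  (forall i, (fibre x).[z i] = 0) -> (fibre x).[y] = 0 -> exists i, y = z i.
Proof.
move=> xS zI zr yr; suff /codomP[i ->] : y \in codom z by exists i.
apply/negPn/negP => yz.
have f0 : fibre x != 0 by rewrite -size_poly_eq0 size_fibre // -lt0n ltnW.
have r_all : all (root (fibre x)) (y :: codom z).
  by apply/allP => w; rewrite inE => /orP[/eqP ->|/codomP[i ->]]; exact/rootP.
have r_uniq : uniq (y :: codom z) by rewrite /= yz map_inj_uniq ?enum_uniq.
have := max_poly_roots f0 r_all r_uniq.
by rewrite /= size_codom card_ord size_fibre // prednK ?ltnn // ltnW.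
Qed.

Lemma cont_neq (f g : V -> C) x : cont_at f x -> cont_at g x -> f x != g x ->
  \forall y \near x, f y != g y.
Proof.
move=> fc gc; rewrite -subr_eq0 -nm_gt0 => d0; have d2 : 0 < nm (f x - g x) / 2 by rewrite divr_gt0.
move: (fc _ d2) (gc _ d2); apply: filterS2 => y fy gy; apply/eqP => fg.
have := nm_tri (f x) (f y) (g x); rewrite {2}fg (nmBC _ (f y)).
by move: fy gy; lra.
Qed.

Lemma SigmaN_near x : ~ Sigma P x -> \forall y \near x, ~ Sigma P y.
Proof.
move=> /eqP xS; have h := analytic_cont (analytic_peval x (lead_coef P * discriminant P)).
by have := cont_neq h (analytic_cont (analytic_const x 0)) xS; apply: filterS => y /eqP.
Qed.

Lemma near_near (x : V) (Q : V -> Prop) : (\forall y \near x, Q y) ->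
  \forall y \near x, \forall z \near (y : V), Q z.
Proof. exact: nbhs_interior. Qed.

Lemma near_forall (I : finType) (x : V) (Q : I -> V -> Prop) :
  (forall i, \forall y \near x, Q i y) -> \forall y \near x, forall i, Q i y.
Proof. by move=> h; exact: (@filter_forall V I Q (nbhs x) _ h). Qed.

Lemma near_neq (x : V) (f : 'I_n -> V -> C) : (forall j, cont_at (f j) x) ->
  injective (f^~ x) -> \forall y \near x, forall j k, j != k -> f j y != f k y.
Proof.
move=> fc fI; apply: near_forall => j; apply: near_forall => k.
have [->|jk] := eqVneq j k; first by apply: filterE.
have jkx : f j x != f k x by apply/eqP => /fI /eqP; exact/negP.
by apply: filterS (cont_neq (fc j) (fc k) jkx).
Qed.

(** Near [x] the values of [f] are n distinct roots, so [g] takes one of them at each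
    point; by continuity it is always the one with the index [i]. *)
Lemma root_germ_unique x (f : 'I_n -> V -> C) (g : V -> C) i :
  ~ Sigma P x -> (forall j, cont_at (f j) x) -> injective (f^~ x) ->
  (forall j, \forall y \near x, (fibre y).[f j y] = 0) ->
  cont_at g x -> (\forall y \near x, (fibre y).[g y] = 0) -> g x = f i x ->
  germ_eq x g (f i).
Proof.
move=> xS fc fI fr gc gr gi.
have neq := near_neq fc fI.
have gneq : \forall y \near x, forall j, j != i -> g y != f j y.
  apply: near_forall => j; have [->|ji] := eqVneq j i; first by apply: filterE.
  have jx : g x != f j x by rewrite gi; apply/eqP => /fI /esym/eqP; exact/negP.
  by apply: filterS (cont_neq gc (fc j) jx).
have fr' := near_forall fr.
have A : \forall y \near x, ~ Sigma P y /\ (fibre y).[g y] = 0.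
  by apply: filterS2 (SigmaN_near xS) gr.
apply: filterS2 (filterI neq gneq) (filterI A fr') => y [ny gny] [[yS gy] fy].
have [|j gj] := @roots_exhaust y (f^~ y) (g y) yS _ fy gy.
  move=> j k e; apply/eqP/negPn/negP => jk.
  by have := ny j k jk; rewrite e eqxx.
have [<- //|ji] := eqVneq j i.
by have := gny j ji; rewrite -gj eqxx.
Qed.

Definition root_system (x : V) (f : 'I_n -> V -> C) :=
  [/\ ~ Sigma P x, injective (f^~ x), forall i, (fibre x).[f i x] = 0 &
      forall i, analytic_at x (f i)].

(** The implicit function theorem at [x] gives n branches that are analytic at [x]
    and continuous nearby.  Applied again at a nearby point, it gives germs that
    coincide with these branches because roots cannot be exchanged continuously;
    hence the branches are analytic at every point of a box. *)
Lemma local_branches x : ~ Sigma P x -> exists f : 'I_n -> V -> C,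
  exists2 e : R, 0 < e &
    forall y : V, (forall i, nm (y 0 i - x 0 i) < e) -> root_system y f.
Proof.
move=> xS; have [z [zI zr]] := fibre_roots xS.
have : forall i, exists f : V -> C, [/\ analytic_at x f, f x = z i &
    \forall y \near x, (fibre y).[f y] = 0].
  by move=> i; apply: simple_root_germ; [exact: zr | exact: fibre_simple (zr i)].
move=> /choice[f fP]; exists f.
have fI : injective (f^~ x).
  by move=> i j; case: (fP i) => _ -> _; case: (fP j) => _ -> _ /zI.
have fr i : \forall y \near x, (fibre y).[f i y] = 0 by case: (fP i).
have fc i : \forall y \near x, cont_at (f i) y.
  case: (fP i) => /analytic_cont_near[e e0 h] _ _.
  by apply/near_cspaceP; exists e.
have inj : \forall y \near x, injective (f^~ y).
  have neq : \forall y \near x, forall j k, j != k -> f j y != f k y.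
    by apply: near_neq => // j; exact: (nbhs_singleton (fc j)).
  apply: filterS neq => y ny j k e; apply/eqP/negPn/negP => jk.
  by have := ny j k jk; rewrite e eqxx.
have all : \forall y \near x, [/\ ~ Sigma P y, injective (f^~ y),
    forall i, \forall w \near y, (fibre w).[f i w] = 0 & forall i, cont_at (f i) y].
  have h1 := near_forall (fun i => near_near (fr i)).
  have h2 := near_forall fc.
  by apply: filterS2 (filterI (SigmaN_near xS) inj) (filterI h1 h2) => y [? ?] [? ?].
have /near_cspaceP[e e0 h] := all; exists e => // y /h[yS yI yr yc].
have yr0 i : (fibre y).[f i y] = 0 by exact: (nbhs_singleton (yr i)).
split=> // i.
have [g [ga gy gr]] := simple_root_germ (yr0 i) (fibre_simple yS (yr0 i)).
by apply: (analytic_eq ga); apply: root_germ_unique => //; exact: analytic_cont.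
Qed.

End Fibres.

(** * Analytic continuation along paths *)

Section Paths.
Variables (R : realType) (N : nat).
Local Notation C := (cplx R).
Local Notation V := (cspace R N).

Definition path_in (A : set V) (a b : V) (gamma : R -> V) :=
  [/\ forall t : R, t \in `[0, 1] -> forall U, nbhs (gamma t) U ->
        \forall s \near t, s \in `[0, 1] -> U (gamma s),
      gamma 0 = a, gamma 1 = b & forall t : R, t \in `[0, 1] -> A (gamma t)].

Lemma path_concat A a b c (gamma delta : R -> V) :
  path_in A a b gamma -> path_in A b c delta -> path_in A a c (concat gamma delta).
Proof.
move=> [cg g0 g1 gA] [cd d0 d1 dA]; split; last 3 first.
- by rewrite concat0.
- by rewrite concat1.
- by move=> t t01; apply: (@concatP R V t A gamma delta t01 gA dA).
move=> t; rewrite in_itv /= => /andP[t0 t1] U tU; apply: near_concat => ht.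
  have t2 : 2 * t \in `[0, 1] by rewrite in_itv /=; lra.
  move: tU; rewrite /concat ht => /(cg _ t2); apply: filterS => s h s01.
  by rewrite [X in U X]concat_l //; exact: h.
have t2 : 2 * t - 1 \in `[0, 1] by rewrite in_itv /=; lra.
have tE : concat gamma delta t = delta (2 * t - 1).
  rewrite /concat; case: leP => // h; have -> : t = 2^-1 by lra.
  by rewrite mulfV ?pnatr_eq0 // subrr g1 d0.
move: tU; rewrite tE => /(cd _ t2); apply: filterS => s h s01 sn0.
by rewrite [X in U X]concat_r //; exact: h.
Qed.

Lemma near_reverse (t : R) (Q : R -> Prop) :
  (\forall s \near 1 - t, Q s) -> \forall s \near t, Q (1 - s).
Proof.
have c : (fun s : R => 1 - s) @ t --> 1 - t by apply: cvgB => //; exact: cvg_cst.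
by move=> /c.
Qed.

Lemma itv_reverse (t : R) : (1 - t \in `[0, 1]) = (t \in `[0, 1]).
Proof. by rewrite !in_itv /=; apply/idP/idP => /andP[? ?]; apply/andP; split; lra. Qed.

Lemma path_reverse A a b (gamma : R -> V) :
  path_in A a b gamma -> path_in A b a (fun t => gamma (1 - t)).
Proof.
move=> [cg g0 g1 gA]; split; [|by rewrite subr0|by rewrite subrr|] => t.
  rewrite -itv_reverse => t01 U /(cg _ t01) /near_reverse; apply: filterS => s h.
  by rewrite -itv_reverse.
by rewrite -itv_reverse; exact: gA.
Qed.

Lemma continues_reverse (gamma : R -> V) f g :
  continues_along gamma f g -> continues_along (fun t => gamma (1 - t)) g f.
Proof.
move=> [F [Fan Fc F0 F1]]; exists (fun t => F (1 - t)).
split; [| |by rewrite !subr0|by rewrite !subrr].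
  by move=> t; rewrite -itv_reverse; exact: Fan.
move=> t; rewrite -itv_reverse => /Fc /near_reverse; apply: filterS => s h.
by rewrite -itv_reverse.
Qed.

Lemma continues_eq (gamma : R -> V) f g f' g' :
  germ_eq (gamma 0) f f' -> germ_eq (gamma 1) g g' ->
  continues_along gamma f g -> continues_along gamma f' g'.
Proof.
move=> ff gg [F [Fan Fc F0 F1]]; exists F; split=> //.
  exact: germ_eq_trans F0 ff.
exact: germ_eq_trans F1 gg.
Qed.

Lemma germ_eq_near (a : V) (f g : V -> C) : germ_eq a f g ->
  \forall y \near a, germ_eq y f g.
Proof. exact: nbhs_interior. Qed.

Lemma continues_along_concat A a b c (gamma delta : R -> V) f g h :
  path_in A a b gamma -> path_in A b c delta ->
  continues_along gamma f g -> continues_along delta g h ->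
  continues_along (concat gamma delta) f h.
Proof.
move=> [cg g0 g1 gA] [cd d0 d1 dA] [F [Fan Fc F0 F1]] [G [Gan Gc G0 G1]].
have FG : germ_eq b (F 1) (G 0).
  by rewrite g1 in F1; rewrite d0 in G0; exact: germ_eq_trans F1 (germ_eq_sym G0).
exists (concat F G); split; [| | by rewrite !concat0 | by rewrite !concat1].
  move=> t; rewrite in_itv /= => t01; rewrite /concat; case: leP => ht.
    by apply: Fan; rewrite in_itv /=; lra.
  by apply: Gan; rewrite in_itv /=; lra.
move=> t; rewrite in_itv /= => /andP[t0 t1]; apply: near_concat => ht.
  have t2 : 2 * t \in `[0, 1] by rewrite in_itv /=; lra.
  have := Fc _ t2; apply: filterS => s hs s01.
  by rewrite !concat_l // /concat ht; exact: hs.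
have t2 : 2 * t - 1 \in `[0, 1] by rewrite in_itv /=; lra.
have [th|th] := leP t 2^-1; last first.
  have := Gc _ t2; apply: filterS => s hs s01 sn0.
  by rewrite !concat_r // /concat leNgt th; exact: hs.
have -> : concat F G t = F 1 by rewrite /concat th; congr F; lra.
have z01 : (0 : R) \in `[0, 1] by rewrite in_itv /= lexx ler01.
(* At the junction the germs on both sides agree in a neighbourhood. *)
have FGn : nbhs (delta 0) [set y | germ_eq y (F 1) (G 0)].
  by rewrite d0; exact: germ_eq_near.
have -> : 2 * t - 1 = 0 by lra.
apply: filterS2 (Gc _ z01) (cd _ z01 _ FGn) => s hs hFG s01 sn0.
rewrite !concat_r //.
by apply: germ_eq_trans (hs s01) _; apply: germ_eq_sym; exact: hFG.
Qed.

End Paths.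

(** * Branches reachable from the base point *)

Section Reach.
Variables (R : realType) (N : nat).
Local Notation C := (cplx R).
Local Notation V := (cspace R N).
Variable P : {poly cpoly R N}.
Hypothesis P_gt1 : (1 < size P)%N.
Local Notation n := (size P).-1.
Variables (x0 : V) (ys : 'I_n -> V -> C).
Hypothesis x0S : ~ Sigma P x0.
Hypothesis ys_germs : lists_germs_of P x0 ys.

Definition branches (x : V) (f : 'I_n -> V -> C) :=
  \forall y \near x, root_system y f.

Lemma branches_germ_unique x f g i : branches x f -> cont_at g x ->
  (\forall y \near x, (fibre P y).[g y] = 0) -> g x = f i x -> germ_eq x g (f i).
Proof.
move=> fb gc gr gi; have [xS fI _ fa] := nbhs_singleton fb.
apply: root_germ_unique => // [j|j]; first exact: analytic_cont.
by apply: filterS fb => y [].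
Qed.

Lemma branches_reindex x f w (s : 'I_n -> 'I_n) : injective s -> branches x f ->
  (forall i, germ_eq x (w i) (f (s i))) -> branches x w.
Proof.
move=> sI fb fw; have h := near_forall (fun i => germ_eq_near (fw i)).
apply: filterS2 fb h => y [yS fI fr fa] fwy.
have e i : w i y = f (s i) y by exact: (nbhs_singleton (fwy i)).
split.
- exact: yS.
- by move=> i j; rewrite (e i) (e j) => /fI/sI.
- by move=> i; rewrite e; exact: fr.
- by move=> i; apply: (analytic_eq (fa (s i))); apply: germ_eq_sym; exact: fwy.
Qed.

Lemma match_branches x f (w : 'I_n -> V -> C) : branches x f ->
  (forall i, cont_at (w i) x) ->
  (forall i, \forall y \near x, (fibre P y).[w i y] = 0) ->
  exists s : 'I_n -> 'I_n, forall i, germ_eq x (w i) (f (s i)).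
Proof.
move=> fb wc wr; have [xS fI fr _] := nbhs_singleton fb.
have : forall i, exists j, w i x = f j x.
  by move=> i; apply: (roots_exhaust P_gt1 xS fI fr); exact: (nbhs_singleton (wr i)).
by move=> /choice[s sP]; exists s => i; apply: branches_germ_unique.
Qed.

Lemma match_branch_systems x f w : branches x f -> branches x w ->
  exists2 s : 'I_n -> 'I_n, injective s & forall i, germ_eq x (w i) (f (s i)).
Proof.
move=> fb wb; have [xS wI _ wa] := nbhs_singleton wb.
have [i|i|s sP] := @match_branches x f w fb.
- exact: analytic_cont.
- by apply: filterS wb => y [].
exists s => // i j sij; apply: wI.
by rewrite (nbhs_singleton (sP i)) (nbhs_singleton (sP j)) sij.
Qed.

(** Two of the listed germs with the same value at [x0] would be equal as germs, so
    their values are distinct there. *)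
Lemma base_branches : branches x0 ys.
Proof.
have [f [e e0 fP]] := local_branches P_gt1 x0S.
have fb : branches x0 f by apply/near_cspaceP; exists e.
have [ysg ysI _] := ys_germs.
have [i|i|s sP] := @match_branches x0 f ys fb.
- by apply: analytic_cont; case: (ysg i).
- by case: (ysg i).
apply: (branches_reindex _ fb sP) => i j sij; apply: ysI.
by apply: germ_eq_trans (sP i) _; rewrite sij; exact: germ_eq_sym.
Qed.

(** The end germs are required to be n distinct roots, so that the permanence of
    algebraic relations under continuation is part of the definition. *)
Definition reach (x : V) (w : 'I_n -> V -> C) := branches x w /\
  exists2 gamma, path_in (~` Sigma P) x0 x gamma &
    forall i, continues_along gamma (ys i) (w i).

Lemma reach_base : reach x0 ys.
Proof.
split; first exact: base_branches.
exists (fun=> x0); first by split=> // t _ U /nbhs_singleton U0; apply: filterE.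
move=> i; exists (fun=> ys i); split=> // [t _|t _||]; last 2 first.
- exact: germ_eq_refl.
- exact: germ_eq_refl.
- by have [_ _ _] := nbhs_singleton base_branches; apply.
by apply: filterE => s _; exact: germ_eq_refl.
Qed.

Definition segment_path (x y : V) (t : R) : V := x + ofR t *: (y - x).

Lemma segment_coord x y t i :
  segment_path x y t 0 i = x 0 i + ofR t * (y 0 i - x 0 i).
Proof. by rewrite !mxE. Qed.

Lemma segment_diff x y s t i :
  segment_path x y s 0 i - segment_path x y t 0 i = ofR (s - t) * (y 0 i - x 0 i).
Proof.
have -> : y 0 i - x 0 i = (y - x) 0 i by rewrite [RHS]mxE [(- x) 0 i]mxE.
have -> : ofR (s - t) = ofR s - ofR t by exact: rmorphB.
rewrite /segment_path; move: (y - x) (ofR s) (ofR t) => v a b.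
rewrite !mxE.
by rewrite opprD addrACA subrr add0r -mulrBl.
Qed.

Lemma segment_path_in (A : set V) x y :
  (forall t : R, t \in `[0, 1] -> A (segment_path x y t)) ->
  path_in A x y (segment_path x y).
Proof.
move=> sA; split=> //; last 2 first.
- by rewrite /segment_path rmorph0 scale0r addr0.
- by rewrite /segment_path rmorph1 scale1r addrC subrK.
move=> t t01 U /near_cspaceP[e e0 eU].
pose M := 1 + \sum_i nm (y 0 i - x 0 i).
have Mi i : nm (y 0 i - x 0 i) < M.
  rewrite /M (bigD1 i) //=; have : 0 <= \sum_(j | j != i) nm (y 0 j - x 0 j).
    by apply: sumr_ge0 => *; exact: nm_ge0.
  lra.
have M0 : 0 < M by rewrite ltr_pwDl // sumr_ge0 // => *; exact: nm_ge0.
apply/nbhs_ballP; exists (e / M); first exact: divr_gt0.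
move=> s st _; rewrite /ball /= distrC in st; apply: eU => i.
rewrite [X in nm X]segment_diff nmM nm_ofR.
apply: le_lt_trans (ler_wpM2l (normr_ge0 _) (ltW (Mi i))) _.
by rewrite -ltr_pdivlMr.
Qed.

Lemma segment_box (c : V) (e : R) (x y : V) (t : R) : t \in `[0, 1] ->
  (forall i, nm (x 0 i - c 0 i) < e) -> (forall i, nm (y 0 i - c 0 i) < e) ->
  forall i, nm (segment_path x y t 0 i - c 0 i) < e.
Proof.
rewrite in_itv /= => /andP[t0 t1] xe ye i; rewrite segment_coord.
have -> : x 0 i + ofR t * (y 0 i - x 0 i) - c 0 i =
    ofR (1 - t) * (x 0 i - c 0 i) + ofR t * (y 0 i - c 0 i).
  by rewrite rmorphB rmorph1; ring.
apply: le_lt_trans (nmD _ _) _; rewrite !nmM !nm_ofR !ger0_norm ?subr_ge0 //.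
have := xe i; have := ye i; set u := nm _; set v := nm _ => h1 h2.
have [t00|tp] := eqVneq t 0; first by rewrite t00 subr0 mul1r mul0r addr0.
have h3 : t * u < t * e by rewrite ltr_pM2l // lt_neqAle eq_sym tp.
have h4 : (1 - t) * v <= (1 - t) * e by rewrite ler_wpM2l ?subr_ge0 // ltW.
by move: h3 h4; clear; lra.
Qed.

(** A box is convex, so branches over it continue along segments.  In particular
    being reachable is an open and closed condition off Sigma. *)
Lemma reach_step x1 : ~ Sigma P x1 -> exists f : 'I_n -> V -> C,
  exists2 e : R, 0 < e &
  (forall y : V, (forall i, nm (y 0 i - x1 0 i) < e) -> branches y f) /\
  forall (x : V) w, (forall i, nm (x 0 i - x1 0 i) < e) -> reach x w ->
    exists2 s : 'I_n -> 'I_n, (forall i, germ_eq x (w i) (f (s i))) &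
      forall x' : V, (forall i, nm (x' 0 i - x1 0 i) < e) -> reach x' (fun i => f (s i)).
Proof.
move=> x1S; have [f [e e0 fP]] := local_branches P_gt1 x1S.
have fb (y : V) : (forall i, nm (y 0 i - x1 0 i) < e) -> branches y f.
  move=> ye.
  suff : \forall z \near y, forall i, nm ((z : V) 0 i - x1 0 i) < e.
    by apply: filterS => z; exact: fP.
  apply: near_forall => i; apply/near_cspaceP; exists (e - nm (y 0 i - x1 0 i)).
    by rewrite subr_gt0.
  by move=> z zy; apply: le_lt_trans (nm_tri _ (y 0 i) _) _; rewrite -ltrBrDr.
exists f, e => //; split=> // x w xe [wb [gamma gp gc]].
have [s sI sP] := match_branch_systems (fb x xe) wb.
exists s; first exact: sP.
move=> x' xe'; split.
  apply: (@branches_reindex x' f (fun i => f (s i)) s sI (fb x' xe')) => i.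
  exact: germ_eq_refl.
have segA (t : R) : t \in `[0, 1] -> root_system (segment_path x x' t) f.
  by move=> t01; apply: fP; exact: segment_box.
have sp : path_in (~` Sigma P) x x' (segment_path x x').
  by apply: segment_path_in => t /segA[].
exists (concat gamma (segment_path x x')); first exact: path_concat gp sp.
move=> i; apply: (continues_along_concat gp sp (g := f (s i))).
  apply: (continues_eq _ _ (gc i)); first exact: germ_eq_refl.
  by case: gp => _ _ -> _.
exists (fun=> f (s i)); split=> [t /segA[]//|t _||]; try exact: germ_eq_refl.
by apply: filterE => ? _; exact: germ_eq_refl.
Qed.

(** Two continuations to the same point differ by the continuation along a loop,
    hence by an element of the monodromy group. *)
Lemma reach_unique x w w' : reach x w -> reach x w' ->
  exists2 s : {perm 'I_n}, s \in monodromy_group P x0 ys &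
    forall i, w i x = w' (s i) x.
Proof.
move=> [wb [gamma gp gc]] [wb' [delta dp dc]].
have [s sI sP] := match_branch_systems wb' wb.
exists (perm sI); last by move=> i; rewrite permE; exact: (nbhs_singleton (sP i)).
have rp := path_reverse dp.
apply/monodromy_groupP; exists (concat gamma (fun t => delta (1 - t))).
  by apply/loop_inP; exact: path_concat gp rp.
move=> i; rewrite permE; apply: (continues_along_concat gp rp (g := w' (s i))).
  apply: (continues_eq _ _ (gc i)); first exact: germ_eq_refl.
  by case: gp => _ _ -> _.
exact: continues_reverse.
Qed.

End Reach.

(** * Expansions along complex lines and the maximum principle *)

Section Lines.
Variables (R : realType) (N : nat).
Local Notation C := (cplx R).
Local Notation V := (cspace R N).

(** Only the error bounds of the Taylor polynomials are recorded: they determine both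
    the coefficients and the function near the origin. *)
Definition expands (phi : C -> C) (e : nat -> C) (r M : R) :=
  0 < r /\ forall d tau, nm tau <= r ->
    nm (phi tau - \sum_(k < d) e k * tau ^+ k) <= M * (nm tau / r) ^+ d.

(** The homogeneous part of degree [k] of the power series, evaluated at [v]. *)
Definition line_coef (c : multinom N -> C) (v : V) k : C :=
  peval v (trunc c k.+1 - trunc c k).

Lemma line_coef_scale c v tau k :
  line_coef c (tau *: v) k = line_coef c v k * tau ^+ k.
Proof.
rewrite /line_coef /peval !mevalE mulr_suml big_seq [RHS]big_seq.
apply: eq_bigr => m; rewrite mcoeff_msupp mcoeffB !mcoeff_trunc => mk.
have {mk} mk : mdeg m = k.
  move: mk; rewrite ltnS; case: (ltngtP (mdeg m) k) => //.
  - by rewrite subrr eqxx.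
  - by rewrite subrr eqxx.
rewrite -mulrA; congr (_ * _); rewrite -mk mdegE -prodrXr -big_split /=.
by apply: eq_bigr => i _; rewrite !mxE exprMn mulrC.
Qed.

Lemma peval_trunc_line c v d : peval v (trunc c d) = \sum_(k < d) line_coef c v k.
Proof.
elim: d => [|d IH].
  rewrite big_ord0 /trunc big1 ?rmorph0 // => -[m /=]; by rewrite ltn0.
by rewrite big_ord_recr /= -IH /line_coef rmorphB /= addrC subrK.
Qed.

Lemma line_expansion a f c r M v : series_at a f (trunc c) r M ->
  exists r', expands (fun tau => f (a + tau *: v)) (line_coef c v) r' M.
Proof.
move=> [r0 _ _ pf]; pose L := 1 + \sum_i nm (v 0 i).
have Li i : nm (v 0 i) <= L.
  rewrite /L (bigD1 i) //=; have : 0 <= \sum_(j | j != i) nm (v 0 j).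
    by apply: sumr_ge0 => *; exact: nm_ge0.
  by set u := nm _; set w := \sum_(_ | _) _; lra.
have L0 : 0 < L by rewrite ltr_pwDl // sumr_ge0 // => *; exact: nm_ge0.
exists (r / L); split=> [|d tau taur]; first by rewrite divr_gt0.
have tr : 0 <= nm tau * L <= r.
  by rewrite mulr_ge0 ?nm_ge0 ?(ltW L0) //= -ler_pdivlMr.
have := pf d (nm tau * L) (a + tau *: v) tr.
rewrite [a + _]addrC addrK peval_trunc_line invf_div mulrA => h.
rewrite (eq_bigr (fun k : 'I_d => line_coef c (tau *: v) k)) => [|k _].
  by apply: h => i; rewrite !mxE addrK nmM ler_wpM2l ?nm_ge0.
by rewrite line_coef_scale.
Qed.

Lemma expands0 phi e r M : expands phi e r M -> phi 0 = e 0%N.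
Proof.
case=> r0 /(_ 1%N 0); rewrite nm0 mul0r expr1 mulr0 big_ord1 expr0 mulr1.
move=> /(_ (ltW r0)) h; apply/eqP.
by rewrite -subr_eq0 -nm_eq0 eq_le h nm_ge0.
Qed.

Lemma expands_const phi e r M : expands phi e r M ->
  (forall k, (0 < k)%N -> e k = 0) -> forall tau, nm tau < r -> phi tau = e 0%N.
Proof.
case=> r0 h e0 tau tr; apply/eqP; rewrite -subr_eq0 -nm_eq0 eq_le nm_ge0 andbT.
apply: (@le_geometric0 _ _ (M * (nm tau / r)) (nm tau / r)).
  by rewrite divr_ge0 ?nm_ge0 ?(ltW r0) // ltr_pdivrMr // mul1r.
move=> d; have := h d.+1 tau (ltW tr).
rewrite big_ord_recl expr0 mulr1 big1 ?addr0; last by move=> i _; rewrite e0 ?mul0r.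
by rewrite exprS mulrA.
Qed.

Lemma le_linear0 (x K r : R) : 0 < r -> (forall t, 0 < t < r -> x <= K * t) -> x <= 0.
Proof.
move=> r0 h; rewrite leNgt; apply/negP => x0.
pose t := Num.min (r / 2) (x / (2 * (`|K| + 1))).
have K1 : 0 < 2 * (`|K| + 1) by have := normr_ge0 K; lra.
have t0 : 0 < t by rewrite lt_min !divr_gt0.
have tr : t < r by rewrite gt_min; apply/orP; left; lra.
have := h t; rewrite t0 tr => /(_ isT).
have : t <= x / (2 * (`|K| + 1)) by rewrite ge_min lexx orbT.
rewrite ler_pdivlMr // => h1 h2.
have h3 : K * t <= `|K| * t by rewrite ler_wpM2r ?ler_norm ?ltW.
by move: h1 h2 h3 t0 x0; clear; lra.
Qed.

(** At the smallest bad index [k], the error bound of order [k + 1] divided by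
    [tau ^ k] forces [e k] to vanish as [tau] tends to 0. *)
Lemma expands_poly phi e r M d : expands phi e r M ->
  (\forall tau \near (0 : C), phi tau = \sum_(k < d) e k * tau ^+ k) ->
  forall k, (d <= k)%N -> e k = 0.
Proof.
case=> r0 h /near_cplxP[s s0 hphi] k; elim/ltn_ind: k => k IH dk.
apply/eqP; rewrite -nm_eq0 eq_le nm_ge0 andbT.
have m0 : 0 < Num.min r s by rewrite lt_min r0.
apply: (@le_linear0 _ (M / r ^+ k.+1) _ m0) => t /andP[t0].
rewrite lt_min => /andP[tr ts].
have tE : nm (ofR t) = t by rewrite nm_ofR ger0_norm // ltW.
have := h k.+1 (ofR t); rewrite tE hphi; last by rewrite subr0 tE.
move=> /(_ (ltW tr)); rewrite big_ord_recr /=.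
rewrite -(subnKC dk) big_split_ord /= [X in _ - (_ + X + _)]big1; last first.
  by move=> i _; rewrite IH ?mul0r ?leq_addr //; have := ltn_ord i; lia.
rewrite addr0 subnKC // opprD addrA subrr add0r nmN nmM nmX tE expr_div_n.
move=> h1; have tk : 0 < t ^+ k by rewrite exprn_gt0.
rewrite -(ler_pM2r tk); apply: le_trans h1 _.
by rewrite (exprS t); set z := _^-1; lra.
Qed.

Lemma sum_first (F : nat -> C) k : (0 < k)%N ->
  (forall j, (0 < j)%N -> (j < k)%N -> F j = 0) -> \sum_(i < k) F i = F 0%N.
Proof.
case: k => // k _ h; rewrite big_ord_recl big1 ?addr0 // => i _.
by rewrite h.
Qed.

(** If a non-constant expansion starts with [e 0 + e k tau^k], then the modulus
    strictly increases in the direction where both terms have the same argument. *)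
Lemma expands_local_max phi e r M : expands phi e r M ->
  (\forall tau \near (0 : C), nm (phi tau) <= nm (phi 0)) ->
  \forall tau \near (0 : C), phi tau = phi 0.
Proof.
move=> E /near_cplxP[s s0 hmax]; have p0 := expands0 E; have [r0 h] := E.
have [e0|e0] := eqVneq (e 0%N) 0.
  apply/near_cplxP; exists s => // tau /hmax; rewrite p0 e0 nm0 => h0.
  by apply/eqP; rewrite -nm_eq0 eq_le h0 nm_ge0.
suff e_const k : (0 < k)%N -> e k = 0.
  apply/near_cplxP; exists r => // tau; rewrite subr0 p0.
  exact: expands_const E e_const tau.
elim/ltn_ind: k => k IH k0; apply/eqP/negPn/negP => ek.
have [n0 nk] : 0 < nm (e 0%N) /\ 0 < nm (e k) by rewrite !nm_gt0.
(* the direction w in which e k w^k has the argument of e 0 *)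
pose u : C := e 0%N / e k * ofR (nm (e k) / nm (e 0%N)).
pose w : C := k.-root u.
have wk : w ^+ k = u by rewrite rootCK.
have nu : nm u = 1.
  rewrite !nmM nmV nm_ofR ger0_norm ?divr_ge0 ?nm_ge0 //.
  by rewrite mulrA mulfVK ?mulfV // gt_eqF.
have nw : nm w = 1.
  apply/eqP; rewrite -(@pexpr_eq1 _ _ k) ?nm_ge0 // -nmX wk nu //.
apply/negP: (nk); rewrite -leNgt.
have m0 : 0 < Num.min r s by rewrite lt_min r0.
apply: (@le_linear0 _ (M / r ^+ k.+1) _ m0) => t /andP[t0].
rewrite lt_min => /andP[tr ts].
have tE : nm (ofR t * w) = t by rewrite nmM nw mulr1 nm_ofR ger0_norm // ltW.
have := hmax (ofR t * w); rewrite subr0 tE p0 => /(_ ts) hm.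
have := h k.+1 (ofR t * w); rewrite tE => /(_ (ltW tr)).
rewrite big_ord_recr /= (sum_first (F := fun i => e i * (ofR t * w) ^+ i)) //; last first.
  by move=> j j0 jk; rewrite IH ?mul0r.
rewrite expr0 mulr1.
have -> : e 0%N + e k * (ofR t * w) ^+ k = e 0%N * ofR (1 + t ^+ k * (nm (e k) / nm (e 0%N))).
  rewrite exprMn wk /u; move: (nm (e k) / nm (e 0%N)) => rr.
  rewrite rmorphD /= rmorph1 rmorphM /= rmorphXn /=.
  rewrite mulrDr mulr1; congr (_ + _).
  by rewrite mulrCA [e k * (_ * _)]mulrA [e k * _]mulrC mulfVK // mulrCA.
set X := e 0%N * _; have nX : nm X = nm (e 0%N) + t ^+ k * nm (e k).
  rewrite /X nmM nm_ofR ger0_norm; last first.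
    by rewrite addr_ge0 // mulr_ge0 ?exprn_ge0 ?(ltW t0) // divr_ge0 ?nm_ge0.
  rewrite mulrDr mulr1 mulrCA [_ * (_ / _)]mulrC mulfVK ?gt_eqF //.
have tri := nm_le_dist X (phi (ofR t * w)).
rewrite nmBC => h1; have {tri} h2 : t ^+ k * nm (e k) <= M * (t / r) ^+ k.+1.
  by move: tri hm h1; rewrite nX; set a := nm _; set b := nm _; set z := _ ^+ k * _; lra.
have tk : 0 < t ^+ k by rewrite exprn_gt0.
rewrite -(ler_pM2l tk); apply: le_trans h2 _.
by rewrite expr_div_n exprS le_eqVlt; apply/orP; left; apply/eqP; field; rewrite expf_neq0 ?gt_eqF.
Qed.

Lemma analytic_local_max (h : V -> C) x v : analytic_at x h ->
  (\forall tau \near (0 : C), nm (h (x + tau *: v)) <= nm (h x)) ->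
  \forall tau \near (0 : C), h (x + tau *: v) = h x.
Proof.
move=> /analytic_trunc[c [r [M S]]] hmax; have [r' E] := line_expansion v S.
have := expands_local_max E; rewrite scale0r addr0; exact.
Qed.

End Lines.

Section GlobalMaximum.
Variable R : realType.
Local Notation C := (cplx R).
Variable H : C -> C.
Hypothesis H_cont : forall t (e : R), 0 < e -> \forall s \near t, nm (H s - H t) < e.
Hypothesis H_max : forall t, H t != 0 ->
  (\forall s \near t, nm (H s) <= nm (H t)) -> \forall s \near t, H s = H t.
Hypothesis H_decay : forall e : R, 0 < e ->
  exists rho : R, forall t, rho <= nm t -> nm (H t) < e.

(** The modulus is smaller than its value at [t0] outside a large square, which is
    compact. *)
Lemma H_attains_max t0 : H t0 != 0 ->
  exists2 t, H t != 0 & forall s, nm (H s) <= nm (H t).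
Proof.
move=> h0; have m0 : 0 < nm (H t0) by rewrite nm_gt0.
have [rho0 hrho0] := H_decay m0; pose rho := Num.max rho0 1.
have hrho t : rho <= nm t -> nm (H t) < nm (H t0).
  by rewrite ge_max => /andP[? _]; exact: hrho0.
have rho_gt0 : 0 < rho by rewrite lt_max ltr01 orbT.
pose K : set (R * R) := `[- rho, rho]%classic `*` `[- rho, rho]%classic.
have Kc : compact K by apply: compact_setX; exact: segment_compact.
have K0 : K !=set0 by exists (0, 0); split; rewrite /= in_itv /=; lra.
pose g (z : R * R) : R := nm (H (Complex z.1 z.2)).
have gc : {within K, continuous g}.
  apply: continuous_subspaceT => -[a b] /=; apply/cvgrPdist_lt => e e0.
  have /near_cplxP[d d0 hd] := H_cont (Complex a b) e0.
  have d2 : 0 < d / 2 by rewrite divr_gt0.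
  exists (ball a (d / 2), ball b (d / 2)); first by split; exact: nbhsx_ballx.
  move=> -[a' b'] [/= ba bb].
  move: ba bb; rewrite /ball /= => ba bb.
  have dist : nm (Complex a' b' - Complex a b) < d.
    apply: le_lt_trans (nm_le_ReIm _) _ => /=.
    by move: ba bb; rewrite distrC (distrC b); lra.
  have := hd _ dist; rewrite /g /= => h1; rewrite ltr_distl.
  have := nm_le_dist (H (Complex a b)) (H (Complex a' b')).
  have := nm_le_dist (H (Complex a' b')) (H (Complex a b)).
  by rewrite (nmBC (H (Complex a b))); move: h1; set u := nm _; lra.
have [z zK zmax] := compact_EVT_max K0 Kc gc.
have gE t : g (complex.Re t, complex.Im t) = nm (H t) by rewrite /g /=; case: t.
have inK t : nm t < rho -> nm (H t) <= g z.
  move=> tr; have := Re_le_nm t; have := Im_le_nm t.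
  rewrite !ler_norml => /andP[? ?] /andP[? ?]; rewrite -gE; apply: zmax.
  by rewrite inE; split; rewrite /= in_itv /=; apply/andP; split; lra.
have t0r : nm t0 < rho by rewrite ltNge; apply/negP => /hrho; rewrite ltxx.
have gz : nm (H t0) <= g z := inK _ t0r.
exists (Complex z.1 z.2); first by rewrite -nm_gt0 (lt_le_trans m0).
move=> s; have [/inK //|/hrho h] := ltP (nm s) rho.
exact: le_trans (ltW h) gz.
Qed.

(** On the ray from a point of maximal modulus, the set of points with the same
    value is closed and, every one of them being a maximum, open; it is bounded
    because the function is small far away, so its supremum is absurd. *)
Lemma vanishing_at_infinity t : H t = 0.
Proof.
apply/eqP/negPn/negP => /H_attains_max[{}t Ht tmax]; set c := H t.
have m0 : 0 < nm c by rewrite nm_gt0.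
pose S := [set s : R | H (t + ofR s) = c].
have S0 : S 0 by rewrite /S /= rmorph0 addr0.
have [rho hrho] := H_decay m0.
have ubS : ubound S (`|rho| + nm t).
  move=> s Hs; rewrite leNgt; apply/negP => sb.
  have : nm (H (t + ofR s)) < nm c.
    apply: hrho; apply: le_trans (ler_norm _) _.
    have := nm_le_dist (ofR s) (- t); rewrite opprK nmN nm_ofR addrC (addrC (ofR s)).
    by have := ler_norm s; move: sb; set u := nm _; set v := nm _; lra.
  by rewrite Hs ltxx.
have supS : has_sup S by split; [exists 0 | exists (`|rho| + nm t)].
pose s := sup S; pose p := t + ofR s.
have shift e (Q : C -> Prop) : (forall z, nm (z - p) < e -> Q z) ->
    forall s', `|s' - s| < e -> Q (t + ofR s').
  move=> hQ s' ss; apply: hQ; rewrite /p opprD addrACA subrr add0r -rmorphB nm_ofR.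
  exact: ss.
have Hp : H p = c.
  apply/eqP; rewrite -subr_eq0 -nm_eq0; apply/eqP/le_anti; rewrite nm_ge0 andbT.
  rewrite leNgt; apply/negP => d0; have /near_cplxP[e e0 he] := H_cont p d0.
  have [s' Ss' s's] := sup_adherent e0 supS.
  have s'le : s' <= s by apply: sup_upper_bound.
  have ss : `|s' - s| < e.
    by rewrite distrC ger0_norm ?subr_ge0 //; move: s's; rewrite -/s; lra.
  by have := shift e _ he s' ss; rewrite Ss' nmBC ltxx.
have /near_cplxP[e e0 he] : \forall z \near p, H z = H p.
  by apply: H_max; rewrite Hp //; apply: filterE => z; exact: tmax.
have : S (s + e / 2).
  rewrite /S /= -Hp; apply: (shift e (fun z => H z = H p)) => //.
  by rewrite addrAC subrr add0r ger0_norm; lra.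
move=> /(sup_upper_bound supS); rewrite -/s; lra.
Qed.

End GlobalMaximum.

(** * Single-valued functions of polynomial growth *)

Section SingleValued.
Variables (R : realType) (N : nat).
Local Notation C := (cplx R).
Local Notation V := (cspace R N).

Lemma decay_rate (a b z w : R) : z != 0 -> w != 0 ->
  a / (w * (w * z)) * (b * z * w) = a * b / w.
Proof. by move=> z0 w0; field; rewrite z0 w0. Qed.

Definition size1 (x : V) : R := 1 + \sum_i nm (x 0 i).

Lemma size1_ge1 x : 1 <= size1 x.
Proof. by rewrite lerDl sumr_ge0 // => *; exact: nm_ge0. Qed.

Lemma size1_ge0 x : 0 <= size1 x.
Proof. exact: le_trans ler01 (size1_ge1 x). Qed.

Lemma coord_le_size1 (x : V) i : nm (x 0 i) <= size1 x.
Proof.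
rewrite /size1 (bigD1 i) //= addrCA lerDl addr_ge0 //.
by apply: sumr_ge0 => *; exact: nm_ge0.
Qed.

Lemma size1_line (x v : V) t : size1 (x + t *: v) <= size1 x + nm t * \sum_i nm (v 0 i).
Proof.
rewrite /size1 -addrA lerD2l mulr_sumr -big_split /=.
by apply: ler_sum => i _; rewrite !mxE -nmM nmD.
Qed.

Lemma peval_growth (q : cpoly R N) x : nm (peval x q) <= wn 1 q * size1 x ^+ msize q.
Proof.
apply: le_trans (nm_peval q (coord_le_size1 x)) _.
rewrite /wn mulr_suml big_seq [leRHS]big_seq; apply: ler_sum => m mq.
rewrite expr1n mulr1 ler_wpM2l ?nm_ge0 // ler_weXn2l ?size1_ge1 //.
by apply: ltnW; exact: msize_mdeg_lt.
Qed.

Lemma near_line (x v : V) (t : C) (Q : V -> Prop) :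
  (\forall y \near x + t *: v, Q y) -> \forall s \near t, Q (x + s *: v).
Proof.
move=> /near_cspaceP[e e0 h]; apply/near_cplxP.
have s0 : 0 < size1 v := lt_le_trans ltr01 (size1_ge1 v).
exists (e / size1 v); first by rewrite divr_gt0.
move=> s st; apply: h => i; rewrite !mxE opprD addrACA subrr add0r -mulrBl nmM.
apply: le_lt_trans (ler_wpM2l (nm_ge0 _) (coord_le_size1 v i)) _.
by rewrite -ltr_pdivlMr.
Qed.

Lemma near_shift (t : C) (Q : C -> Prop) :
  (\forall s \near t, Q s) <-> (\forall tau \near (0 : C), Q (t + tau)).
Proof.
split=> /near_cplxP[e e0 h]; apply/near_cplxP; exists e => // s.
  by rewrite subr0 => se; apply: h; rewrite addrAC subrr add0r.
by move=> se; rewrite -(subrK t s) addrC; apply: h; rewrite subr0.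
Qed.

Variables (D : cpoly R N) (A : set V) (g : V -> C) (x0 : V) (K : R) (d : nat).
Hypothesis A_off : forall x, A x -> peval x D != 0.
Hypothesis A_open : forall x, A x -> \forall y \near x, A y.
Hypothesis A_closed : forall x, peval x D != 0 -> ~ A x -> \forall y \near x, ~ A y.
Hypothesis g_analytic : forall x, A x -> analytic_at x g.
Hypothesis g_growth : forall x, A x -> nm (g x) <= K * size1 x ^+ d.
Hypothesis A_x0 : A x0.

Section OnLine.
Variables (v : V) (i0 : 'I_N) (e : nat -> C) (r M : R).
Hypothesis v_i0 : v 0 i0 != 0.
Hypothesis g_expands : expands (fun t => g (x0 + t *: v)) e r M.

(** [G] is bounded near every point, including those where it is not analytic, and
    is O(1/t) at infinity.  The factor [D t] vanishes at the bad points; the exponent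
    [nu] exceeds its degree by one, so [H] still tends to 0 at infinity. *)
Let X (t : C) : V := x0 + t *: v.
Let T (t : C) : C := \sum_(k < d.+1) e k * t ^+ k.
Let nu := (msize D).+2.
Let G (t : C) : C := (g (X t) - T t) / t ^+ d.+1.
Let H (t : C) : C :=
  if `[< A (X t) >] && (t != 0) then G t ^+ nu * (peval (X t) D * t) else 0.

Let coord : cpoly R N := (mpolyX _ (mnm1 i0) - mpolyC N (x0 0 i0)) * mpolyC N (v 0 i0)^-1.
Let h (x : V) : C :=
  ((g x - \sum_(k < d.+1) e k * peval x coord ^+ k) * (peval x coord)^-1 ^+ d.+1) ^+ nu
  * peval x (D * coord).

Lemma coordE t : peval (X t) coord = t.
Proof.
rewrite rmorphM rmorphB /= !pevalC /peval mevalXU !mxE addrAC subrr add0r.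
by rewrite mulfK.
Qed.

Lemma DcoordE t : peval (X t) (D * coord) = peval (X t) D * t.
Proof. by rewrite pevalM coordE. Qed.

Lemma HE t : A (X t) -> t != 0 -> H t = h (X t).
Proof.
move=> At t0; rewrite /H (asboolT At) t0 /= /h DcoordE coordE /G.
by rewrite exprVn.
Qed.

Lemma h_analytic (t : C) : A (X t) -> t != 0 -> analytic_at (X t) h.
Proof.
move=> At t0; have ga := g_analytic At.
have ca := analytic_peval (X t) coord.
apply: analyticM; last exact: analytic_peval.
apply: analyticX; apply: analyticM; last first.
  by apply: analyticX; apply: analytic_inv; rewrite coordE.
rewrite (_ : (fun x => _) = (fun x => g x + \sum_(k < d.+1) (- e k) * peval x coord ^+ k)).
  apply: (analyticD ga).
  apply: (@analytic_sum R N (X t) _ (index_enum 'I_d.+1)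
    (fun k x => - e k * peval x coord ^+ k)) => k.
  exact: analyticM (analytic_const (X t) (- e k)) (analyticX k ca).
apply/funext => x; rewrite -sumrN; congr (_ + _); apply: eq_bigr => k _.
by rewrite mulNr.
Qed.

Lemma A_near (t : C) : A (X t) -> \forall s \near t, A (X s).
Proof. by move=> /A_open; exact: near_line. Qed.

Lemma neq0_near (t : C) : t != 0 -> \forall s \near t, s != 0.
Proof.
move=> t0; apply/near_cplxP; exists (nm t); first by rewrite nm_gt0.
by move=> s st; apply/eqP => s0; move: st; rewrite s0 sub0r nmN ltxx.
Qed.

Lemma H_near (t : C) : A (X t) -> t != 0 -> \forall s \near t, H s = h (X s).
Proof.
move=> At t0; apply: filterS2 (A_near At) (neq0_near t0) => s; exact: HE.
Qed.

(** Near t = 0 by the error bound of the Taylor polynomial, elsewhere because of the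
    growth condition. *)
Lemma G_bounded (t : C) : exists2 B : R, 0 <= B &
  \forall s \near t, A (X s) -> s != 0 -> nm (G s) <= B.
Proof.
have [r0 hg] := g_expands.
have M0 : 0 <= M.
  have := hg 0%N 0; rewrite nm0 expr0 mulr1 => /(_ (ltW r0)); apply: le_trans.
  exact: nm_ge0.
have [->|t0] := eqVneq t 0.
  exists (M / r ^+ d.+1); first by rewrite divr_ge0 // exprn_ge0 // ltW.
  apply/near_cplxP; exists r => // s; rewrite subr0 => sr As s0.
  have := hg d.+1 s (ltW sr); rewrite -/(T s) => h1.
  have ns : 0 < nm s ^+ d.+1 by rewrite exprn_gt0 // nm_gt0.
  rewrite /G nmM nmV nmX ler_pdivrMr //; apply: le_trans h1 _.
  by rewrite expr_div_n mulrA mulrAC.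
have n0 : 0 < nm t by rewrite nm_gt0.
pose rho := 2 * nm t; pose b := size1 x0 + rho * \sum_i nm (v 0 i).
pose B1 := `|K| * b ^+ d + \sum_(k < d.+1) nm (e k) * rho ^+ k.
have v0 : 0 <= \sum_i nm (v 0 i) by apply: sumr_ge0 => *; exact: nm_ge0.
have rho0 : 0 <= rho by rewrite mulr_ge0 ?nm_ge0.
have b0 : 0 <= b by apply: addr_ge0; [exact: size1_ge0 | exact: mulr_ge0].
have B10 : 0 <= B1.
  rewrite addr_ge0 ?mulr_ge0 ?exprn_ge0 // sumr_ge0 // => *.
  by rewrite mulr_ge0 ?nm_ge0 ?exprn_ge0.
have t20 : 0 < nm t / 2 by rewrite divr_gt0.
exists (B1 / (nm t / 2) ^+ d.+1); first by rewrite divr_ge0 // exprn_ge0 // ltW.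
apply/near_cplxP; exists (nm t / 2) => // s st As s0.
have s1 : nm s <= rho.
  by have := nm_le_dist s t; move: st n0; rewrite /rho; set u := nm _; set w := nm _; lra.
have s2 : nm t / 2 <= nm s.
  by have := nm_le_dist t s; rewrite nmBC; move: st; set u := nm _; set w := nm _; lra.
have ns : 0 < nm s by rewrite nm_gt0.
have h1 : nm (g (X s) - T s) <= B1.
  apply: le_trans (nmB _ _) _; apply: lerD.
    apply: le_trans (g_growth As) _.
    apply: (@le_trans _ _ (`|K| * size1 (X s) ^+ d)).
      by rewrite ler_wpM2r ?ler_norm // exprn_ge0 // size1_ge0.
    have sz := size1_ge0 (X s).
    rewrite ler_wpM2l // lerXn2r ?nnegrE //.
    by apply: le_trans (size1_line _ _ _) _; rewrite lerD2l ler_wpM2r.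
  apply: le_trans (nm_sum _ _ _) _; apply: ler_sum => k _.
  by rewrite nmM nmX ler_wpM2l ?nm_ge0 // lerXn2r ?nnegrE ?nm_ge0.
rewrite /G nmM nmV nmX; apply: ler_pM => //; rewrite ?nm_ge0 ?invr_ge0 ?exprn_ge0 ?nm_ge0 //.
rewrite lef_pV2 ?posrE ?exprn_gt0 //.
by rewrite lerXn2r ?nnegrE ?nm_ge0 // ltW.
Qed.

Lemma H_le s B : 0 <= B -> (A (X s) -> s != 0 -> nm (G s) <= B) ->
  nm (H s) <= B ^+ nu * nm (peval (X s) D * s).
Proof.
move=> B0 Gs; rewrite /H; case: ifP => [/andP[/asboolP As s0]|_]; last first.
  by rewrite nm0 mulr_ge0 ?nm_ge0 ?exprn_ge0.
rewrite nmM nmX; apply: ler_wpM2r; first exact: nm_ge0.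
by apply: lerXn2r; rewrite ?nnegrE ?nm_ge0 // Gs.
Qed.

Lemma H_continuous0 (t : C) (eps : R) : H t = 0 -> peval (X t) D * t = 0 -> 0 < eps ->
  \forall s \near t, nm (H s - H t) < eps.
Proof.
move=> Ht Dt eps0; rewrite Ht; have [B B0 GB] := G_bounded t.
have B1 : 0 < B ^+ nu + 1 by rewrite ltr_wpDl ?exprn_ge0.
have cD := analytic_cont (analytic_peval (X t) (D * coord)) (divr_gt0 eps0 B1).
have E1 s : peval (X s) (D * coord) - peval (X t) (D * coord) = peval (X s) D * s.
  exact: etrans (f_equal2 (fun a b : C => a - b) (DcoordE s) (etrans (DcoordE t) Dt)) (subr0 _).
apply: filterS2 GB (near_line cD) => s Gs Ds; rewrite subr0.
apply: le_lt_trans (H_le B0 Gs) _.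
move: Ds; rewrite -/(X s) -/(X t) E1 ltr_pdivlMr // mulrDr mulr1 mulrC => Ds.
by apply: le_lt_trans Ds; rewrite lerDl nm_ge0.
Qed.

Lemma H_continuous (t : C) (eps : R) : 0 < eps -> \forall s \near t, nm (H s - H t) < eps.
Proof.
move=> eps0; have [At|nAt] := pselect (A (X t)); last first.
  have Ht : H t = 0 by rewrite /H (asboolF nAt).
  have [Dt|Dt] := eqVneq (peval (X t) D) 0.
    by apply: H_continuous0 => //; rewrite Dt mul0r.
  apply: filterS (near_line (A_closed Dt nAt)) => s As.
  by rewrite Ht /H (asboolF As) subrr nm0.
have [t0|t0] := eqVneq t 0.
  by apply: H_continuous0 => //; rewrite /H t0 ?mulr0 // eqxx andbF.
have hc := analytic_cont (h_analytic At t0).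
apply: filterS2 (H_near At t0) (near_line (hc _ eps0)) => s -> .
by rewrite (HE At t0).
Qed.

Lemma H_local_max (t : C) : H t != 0 ->
  (\forall s \near t, nm (H s) <= nm (H t)) -> \forall s \near t, H s = H t.
Proof.
move=> Ht Hmax; have [At t0] : A (X t) /\ t != 0.
  by move: Ht; rewrite {1}/H; case: ifP => [/andP[/asboolP]|_] //; rewrite eqxx.
have XD tau : X (t + tau) = X t + tau *: v by rewrite /X scalerDl addrA.
have Hh := H_near At t0.
have hmax : \forall tau \near (0 : C), nm (h (X t + tau *: v)) <= nm (h (X t)).
  apply: filterS2 ((near_shift t _).1 Hmax) ((near_shift t _).1 Hh) => tau.
  by rewrite (HE At t0) => h1 h2; rewrite -XD -h2.
have := analytic_local_max (h_analytic At t0) hmax => hconst.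
apply/(near_shift t); apply: filterS2 hconst ((near_shift t _).1 Hh) => tau h1 h2.
exact: etrans h2 (etrans (congr1 h (XD tau)) (etrans h1 (esym (HE At t0)))).
Qed.

Lemma H_decay (eps : R) : 0 < eps -> exists rho : R, forall t, rho <= nm t -> nm (H t) < eps.
Proof.
move=> eps0; pose beta := size1 x0 + \sum_i nm (v 0 i).
have v0 : 0 <= \sum_i nm (v 0 i) by apply: sumr_ge0 => *; exact: nm_ge0.
have beta0 : 0 <= beta by apply: addr_ge0 => //; exact: size1_ge0.
have line t : 1 <= nm t -> size1 (X t) <= beta * nm t.
  move=> t1; apply: le_trans (size1_line _ _ _) _; rewrite /beta mulrDl mulrC lerD2r.
  by rewrite ler_peMr // size1_ge0.
have lineX t k : 1 <= nm t -> size1 (X t) ^+ k <= beta ^+ k * nm t ^+ k.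
  move=> t1; by rewrite -exprMn lerXn2r ?nnegrE ?mulr_ge0 ?nm_ge0 ?line // size1_ge0.
pose K3 := `|K| * beta ^+ d + \sum_(k < d.+1) nm (e k).
have K30 : 0 <= K3.
  by rewrite addr_ge0 ?mulr_ge0 ?exprn_ge0 // sumr_ge0 // => *; exact: nm_ge0.
pose KD := wn 1 D * beta ^+ msize D.
have KD0 : 0 <= KD by rewrite mulr_ge0 ?wn_ge0 ?exprn_ge0.
pose K5 := K3 ^+ nu * KD.
have K50 : 0 <= K5 by rewrite mulr_ge0 ?exprn_ge0.
exists (Num.max 1 (K5 / eps + 1)) => t; rewrite ge_max => /andP[t1 t2].
rewrite /H; case: ifP => [/andP[/asboolP At t0]|_]; last by rewrite nm0.
have nt : 0 < nm t by rewrite nm_gt0.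
have hg : nm (g (X t) - T t) <= K3 * nm t ^+ d.
  apply: le_trans (nmB _ _) _; rewrite mulrDl; apply: lerD.
    apply: le_trans (g_growth At) _.
    apply: (@le_trans _ _ (`|K| * size1 (X t) ^+ d)).
      by rewrite ler_wpM2r ?ler_norm // exprn_ge0 // size1_ge0.
    by rewrite -mulrA ler_wpM2l // lineX.
  apply: le_trans (nm_sum _ _ _) _; rewrite mulr_suml; apply: ler_sum => k _.
  by rewrite nmM nmX ler_wpM2l ?nm_ge0 // ler_weXn2l // -ltnS.
have hG : nm (G t) <= K3 / nm t.
  rewrite /G nmM nmV nmX exprS invfM mulrCA mulrA.
  rewrite [leRHS]mulrC; apply: le_trans (_ : (nm t)^-1 * (K3 * nm t ^+ d) * (nm t ^+ d)^-1 <= _).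
    by rewrite ler_wpM2r ?invr_ge0 ?exprn_ge0 ?nm_ge0 // ler_wpM2l ?invr_ge0 ?nm_ge0.
  by rewrite -!mulrA mulfV ?mulr1 // expf_neq0 // gt_eqF.
have hD : nm (peval (X t) D) <= KD * nm t ^+ msize D.
  apply: le_trans (peval_growth _ _) _; rewrite /KD -mulrA.
  by rewrite ler_wpM2l ?wn_ge0 ?lineX.
have hH : nm (G t ^+ nu * (peval (X t) D * t)) <= K5 / nm t.
  rewrite nmM nmX (nmM _ t).
  apply: le_trans (_ : (K3 / nm t) ^+ nu * (KD * nm t ^+ msize D * nm t) <= _).
    apply: ler_pM; rewrite ?exprn_ge0 ?mulr_ge0 ?nm_ge0 //.
      by rewrite lerXn2r ?nnegrE ?nm_ge0 // divr_ge0 ?nm_ge0.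
    by rewrite ler_wpM2r ?nm_ge0.
  have ntE : nm t ^+ nu = nm t * (nm t * nm t ^+ msize D) by rewrite /nu !exprS.
  have t0' : nm t != 0 by rewrite gt_eqF.
  by rewrite expr_div_n ntE /K5 decay_rate // expf_neq0.
apply: le_lt_trans hH _; rewrite ltr_pdivrMr // mulrC -ltr_pdivrMr //.
by apply: lt_le_trans t2; rewrite ltrDl.
Qed.

Lemma line_polynomial k : (d < k)%N -> e k = 0.
Proof.
move=> dk; apply: (expands_poly (d := d.+1) g_expands) dk.
have H0 := vanishing_at_infinity H_continuous H_local_max H_decay.
have A0 : A (X 0) by rewrite /X scale0r addr0.
have An := A_near A0.
apply: filterS An => t At; have [->|t0] := eqVneq t 0.
  rewrite (expands0 g_expands) big_ord_recl expr0 mulr1 big1 ?addr0 // => i _.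
  by rewrite exprS mul0r mulr0.
have := H0 t; rewrite /H (asboolT At) t0 /= => /eqP.
rewrite mulf_eq0 (mulf_eq0 (peval _ _)) (negPf (A_off At)) (negPf t0) /= orbF.
rewrite expf_eq0 => /andP[_]; rewrite mulf_eq0 invr_eq0 (negPf (expf_neq0 _ t0)) orbF.
by rewrite subr_eq0 => /eqP.
Qed.

End OnLine.

(** Along every complex line through [x0] the function is a polynomial of degree at
    most [d], so the homogeneous parts of its Taylor series of degree above [d]
    vanish identically. *)
Lemma single_valued_polynomial : exists Q : cpoly R N, \forall x \near x0, g x = peval x Q.
Proof.
have [c [r [M S]]] := analytic_trunc (g_analytic A_x0).
exists (shift_poly (- x0) (trunc c d.+1)).
have coef0 (v : V) k : (d < k)%N -> line_coef c v k = 0.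
  move=> dk; have [[i vi]|v0] := pselect (exists i, v 0 i != 0).
    have [r' E] := line_expansion v S.
    exact: line_polynomial vi E k dk.
  have -> : v = 0 *: v.
    apply/rowP => i; rewrite !mxE mul0r; apply/eqP/negPn/negP => vi.
    by apply: v0; exists i.
  by rewrite line_coef_scale; case: k dk => // k _; rewrite exprS mul0r mulr0.
have [r0 _ _ pg] := S.
apply/near_cspaceP; exists (r / 2); first by rewrite divr_gt0.
move=> x xr; rewrite peval_shift; apply/eqP; rewrite -subr_eq0 -nm_eq0 eq_le nm_ge0 andbT.
have q01 : 0 <= r / 2 / r < 1.
  by rewrite mulrAC mulfV ?gt_eqF // mul1r; apply/andP; split; lra.
apply: (@le_geometric0 _ _ (M * (r / 2 / r) ^+ d.+1) _ q01) => k.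
have rr : 0 <= r / 2 <= r by apply/andP; split; lra.
have tE : peval (x - x0) (trunc c (d.+1 + k)) = peval (x - x0) (trunc c d.+1).
  rewrite !peval_trunc_line big_split_ord /= [X in _ + X]big1 ?addr0 // => i _.
  by rewrite coef0 // ltnS leq_addr.
have := pg (d.+1 + k)%N (r / 2) x rr (fun i => ltW (xr i)).
by rewrite tE (exprD _ d.+1) mulrA.
Qed.

End SingleValued.

(** * Invariants of the monodromy group are rational *)

Section Invariants.
Variables (R : realType) (N : nat).
Local Notation C := (cplx R).
Local Notation V := (cspace R N).

(** [lead_coef p * z] is a root of a monic polynomial whose other coefficients are
    those in the sum. *)
Lemma root_bound (p : {poly C}) (z : C) : (1 < size p)%N -> p.[z] = 0 ->
  nm (lead_coef p * z) <=
    1 + \sum_(i < (size p).-1) nm (p`_i * lead_coef p ^+ ((size p).-2 - i)).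
Proof.
case pE : (size p) => [|[|n]] //= _ pz; set l := lead_coef p; set w := l * z.
set S := \sum_(_ < _) _; have S0 : 0 <= S by apply: sumr_ge0 => *; exact: nm_ge0.
have [w1|w1] := leP (nm w) 1; first by apply: le_trans w1 _; rewrite lerDl.
suff : nm w <= S by lra.
have wn : w ^+ n.+1 = - \sum_(i < n.+1) p`_i * l ^+ (n - i) * w ^+ i.
  apply/eqP; rewrite -addr_eq0; apply/eqP.
  have := pz; rewrite horner_coef pE big_ord_recr /= => /(congr1 (fun u => l ^+ n * u)).
  rewrite mulr0 mulrDr mulr_sumr => E; rewrite -[RHS]E addrC; congr (_ + _).
    apply: eq_bigr => i _; have lE : l ^+ n = l ^+ (n - i) * l ^+ i.
      by rewrite -exprD subnK // -ltnS.
    by rewrite lE exprMn -!mulrA mulrCA; congr (_ * _); rewrite mulrCA.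
  have -> : p`_n.+1 = l by rewrite /l lead_coefE pE.
  by rewrite exprMn exprSr mulrA.
have w0 : 0 < nm w by exact: lt_trans ltr01 w1.
rewrite -(ler_pM2r (exprn_gt0 n w0)) -exprS -nmX wn nmN mulr_suml.
apply: le_trans (nm_sum _ _ _) _; apply: ler_sum => i _.
rewrite nmM ler_wpM2l ?nm_ge0 // nmX ler_weXn2l ?(ltW w1) //.
by rewrite -ltnS.
Qed.

Lemma meval_bound n (q : cpoly R n) (z : 'I_n -> C) (l : C) (B : R) k :
  (msize q <= k)%N -> nm l <= B -> (forall i, nm (l * z i) <= B) ->
  nm (l ^+ k * meval z q) <= wn 1 q * B ^+ k.
Proof.
move=> qk lB zB; have B0 : 0 <= B by exact: le_trans (nm_ge0 l) lB.
rewrite mevalE mulr_sumr /wn mulr_suml; apply: le_trans (nm_sum _ _ _) _.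
rewrite big_seq [leRHS]big_seq; apply: ler_sum => m mq.
have mk : (mdeg m <= k)%N by apply: leq_trans qk; apply: ltnW; exact: msize_mdeg_lt.
have -> : l ^+ k * (mcoeff m q * \prod_i z i ^+ m i) =
    mcoeff m q * (l ^+ (k - mdeg m) * \prod_i (l * z i) ^+ m i).
  rewrite mulrCA; congr (_ * _); rewrite -{1}(subnK mk) exprD -mulrA; congr (_ * _).
  rewrite [in LHS]mdegE -prodrXr -big_split /=; apply: eq_bigr => i _.
  by rewrite exprMn.
rewrite expr1n mulr1 nmM ler_wpM2l ?nm_ge0 // nmM -{2}(subnK mk) exprD.
apply: ler_pM; rewrite ?nm_ge0 //.
  by rewrite nmX lerXn2r ?nnegrE ?nm_ge0.
rewrite nm_prod mdegE -prodrXr; apply: ler_prod => i _.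
by rewrite nmX exprn_ge0 ?nm_ge0 //= lerXn2r ?nnegrE ?nm_ge0.
Qed.

Variable P : {poly cpoly R N}.
Hypothesis P_gt1 : (1 < size P)%N.
Local Notation n := (size P).-1.

Lemma fibre_growth : exists (K : R) (d : nat), forall x, ~ Sigma P x ->
  nm (peval x (lead_coef P)) <= K * size1 x ^+ d /\
  forall z, (fibre P x).[z] = 0 -> nm (peval x (lead_coef P) * z) <= K * size1 x ^+ d.
Proof.
pose c (i : 'I_n) := P`_i * lead_coef P ^+ ((size P).-2 - i).
pose d := (msize (lead_coef P) + \sum_i msize (c i))%N.
pose K := 1 + wn 1 (lead_coef P) + \sum_i wn 1 (c i).
have w0 (q : cpoly R N) : 0 <= wn 1 q by exact: wn_ge0.
have sw0 : 0 <= \sum_i wn 1 (c i) by apply: sumr_ge0.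
exists K, d => x xS; have s1 := size1_ge1 x; have s0 := size1_ge0 x.
have grow q : (msize q <= d)%N -> nm (peval x q) <= wn 1 q * size1 x ^+ d.
  by move=> qd; apply: le_trans (peval_growth q x) _; rewrite ler_wpM2l // ler_weXn2l.
have sd : 1 <= size1 x ^+ d by apply: exprn_ege1.
have cg : \sum_i nm (peval x (c i)) <= (\sum_i wn 1 (c i)) * size1 x ^+ d.
  rewrite mulr_suml; apply: ler_sum => i _; apply: grow.
  by rewrite /d (bigD1 i) //= addnCA leq_addr.
have lg := grow _ (leq_addr _ _ : (msize (lead_coef P) <= d)%N).
split=> [|z zr].
  apply: le_trans lg _; rewrite ler_wpM2r ?exprn_ge0 // /K.
  by rewrite -addrA addrCA lerDl addr_ge0.
have lE : lead_coef (fibre P x) = peval x (lead_coef P).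
  by rewrite lead_coefE size_fibre // coef_map /= -lead_coefE.
have := @root_bound (fibre P x) z; rewrite size_fibre // lE => /(_ P_gt1 zr) h.
apply: le_trans h _.
rewrite (eq_bigr (fun i => nm (peval x (c i)))) => [|i _]; last first.
  by rewrite /c rmorphM rmorphXn /= /fibre coef_map.
rewrite /K -addrA mulrDl mul1r; apply: lerD => //.
apply: le_trans cg _; rewrite ler_wpM2r ?exprn_ge0 //.
by rewrite lerDr.
Qed.

Variables (x0 : V) (ys : 'I_n -> V -> C).
Hypothesis x0S : ~ Sigma P x0.
Hypothesis ys_germs : lists_germs_of P x0 ys.

Lemma meval_msym (s : {perm 'I_n}) (z : 'I_n -> C) (q : cpoly R n) :
  meval z (msym s q) = meval (fun i => z (s i)) q.
Proof.
elim/mpolyind: q => [|c m q _ _ IH]; first by rewrite msym0 !meval0.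
rewrite msymD !mevalD msymZ !mevalZ msymX !mevalX IH; congr (_ * _ + _).
rewrite (reindex_inj (@perm_inj _ s)); apply: eq_bigr => i _.
by rewrite mnmE permK.
Qed.

(** The value of an invariant at a point does not depend on the path along which the
    branches are continued to it; the power of the leading coefficient makes up for
    the poles of the roots. *)
Lemma invariant_rational (q : cpoly R n) :
  (forall s, s \in monodromy_group P x0 ys -> msym s q = q) ->
  exists Q : cpoly R N, \forall x \near x0,
    peval x (lead_coef P) ^+ msize q * meval (fun i => ys i x) q = peval x Q.
Proof.
move=> q_inv; set k := msize q.
pose val x (w : 'I_n -> V -> C) := peval x (lead_coef P) ^+ k * meval (fun i => w i x) q.
pose A := [set x | exists w, reach x0 ys x w].
have : forall x, exists u : C, forall w, reach x0 ys x w -> u = val x w.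
  move=> x; have [[w rw]|nr] := pselect (A x); last first.
    by exists 0 => w rw; case: nr; exists w.
  exists (val x w) => w' rw'; have [s sG sE] := reach_unique P_gt1 rw rw'.
  rewrite /val -[in RHS](q_inv s sG) meval_msym; congr (_ * _).
  by apply: meval_eq => i; rewrite sE.
move=> /choice[g gP].
have A_off x : A x -> ~ Sigma P x.
  by case=> w [wb _]; have [] := nbhs_singleton wb.
have A_box x1 : ~ Sigma P x1 -> exists2 e : R, 0 < e &
    forall x y : V, (forall i, nm (x 0 i - x1 0 i) < e) ->
      (forall i, nm (y 0 i - x1 0 i) < e) -> A x -> A y.
  move=> /(reach_step P_gt1 x0 ys)[f [e e0 [_ fP]]]; exists e => // x y xe ye [w rw].
  by have [s _ /(_ y ye) sr] := fP x w xe rw; exists (fun i => f (s i)).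
have center (x : V) (e : R) : 0 < e -> forall i, nm (x 0 i - x 0 i) < e.
  by move=> e0 i; rewrite subrr nm0.
have local x w : reach x0 ys x w -> \forall y \near x, g y = val y w.
  move=> rw; have xS : ~ Sigma P x by apply: A_off; exists w.
  have [f [e e0 [_ fP]]] := reach_step P_gt1 x0 ys xS.
  have [s sE sr] := fP x w (center x e e0) rw.
  have near_sr : \forall y \near x, reach x0 ys y (fun i => f (s i)).
    by apply/near_cspaceP; exists e.
  apply: filterS2 near_sr (near_forall sE) => y /gP -> sEy; rewrite /val.
  by congr (_ * _); apply: meval_eq => i; rewrite sEy.
have [K [d Kd]] := fibre_growth.
have := @single_valued_polynomial R N (lead_coef P * discriminant P) A g x0
  (wn 1 q * K ^+ k) (d * k)%N.
case.
- by move=> x /A_off xS; apply/eqP.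
- move=> x Ax; have [e e0 h] := A_box x (A_off x Ax).
  by apply/near_cspaceP; exists e => // y ye; exact: h (center x e e0) ye Ax.
- move=> x /eqP xS nA; have [e e0 h] := A_box x xS.
  apply/near_cspaceP; exists e => // y ye Ay; apply: nA.
  exact: h ye (center x e e0) Ay.
- move=> x [w rw]; have [wb _] := rw; have [_ _ _ wa] := nbhs_singleton wb.
  apply: (@analytic_eq _ _ _ (fun y => val y w)); last first.
    by apply: germ_eq_sym; exact: local.
  by apply: analyticM; [apply: analyticX; exact: analytic_peval | exact: analytic_meval].
- move=> x [w rw]; have xS : ~ Sigma P x by apply: A_off; exists w.
  rewrite (gP x w rw) /val; have [lB zB] := Kd x xS.
  have [wb _] := rw; have [_ _ wr _] := nbhs_singleton wb.
  apply: le_trans (meval_bound (leqnn _) lB (fun i => zB _ (wr i))) _.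
  by rewrite exprMn -exprM mulrA.
- by exists ys; exact: reach_base.
move=> Q hQ; exists Q; apply: filterS2 hQ (local x0 ys (reach_base P_gt1 x0S ys_germs)).
by move=> x <- ->.
Qed.

End Invariants.

(** * Solvable groups and radicals *)

Section RadicalClosure.
Variable W : pzRingType.
Implicit Types (S : W -> Prop) (w : W).

Inductive radical_closure S : W -> Prop :=
| rc_base w : S w -> radical_closure S w
| rc_add w1 w2 : radical_closure S w1 -> radical_closure S w2 ->
    radical_closure S (w1 + w2)
| rc_mul w1 w2 : radical_closure S w1 -> radical_closure S w2 ->
    radical_closure S (w1 * w2)
| rc_root w k : (0 < k)%N -> radical_closure S (w ^+ k) -> radical_closure S w.

Lemma radical_closure_trans S S' w :
  (forall u, S u -> radical_closure S' u) ->
  radical_closure S w -> radical_closure S' w.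
Proof.
move=> SS'; elim=> [u /SS' //|u v _ ? _ ?|u v _ ? _ ?|u k k0 _ ?].
- exact: rc_add.
- exact: rc_mul.
- exact: rc_root k0 _.
Qed.

Lemma rc_sum S I (r : seq I) (F : I -> W) : radical_closure S 0 ->
  (forall i, radical_closure S (F i)) -> radical_closure S (\sum_(i <- r) F i).
Proof.
move=> S0 SF; elim: r => [|i r IH]; first by rewrite big_nil.
by rewrite big_cons; apply: rc_add.
Qed.

(** A proof of membership in the radical closure, flattened into a list: a germ is
    represented by radicals through a sequence of this shape. *)
Definition derivation S (s : seq W) := forall i, (i < size s)%N ->
  [\/ S s`_i,
      exists j l, [/\ (j < i)%N, (l < i)%N &
        s`_i = s`_j + s`_l \/ s`_i = s`_j * s`_l] |
      exists j k, [/\ (j < i)%N, (0 < k)%N & s`_i ^+ k = s`_j]].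

Lemma derivation_cat S s1 s2 : derivation S s1 -> derivation S s2 ->
  derivation S (s1 ++ s2).
Proof.
move=> d1 d2 i; rewrite size_cat; have [i1 _|i1 is2] := ltnP i (size s1).
  rewrite nth_cat i1; case: (d1 i i1) => [?|[j [l [ji li h]]]|[j [k [ji k0 h]]]].
  - by constructor 1.
  - constructor 2; exists j, l.
    by rewrite !nth_cat (ltn_trans ji i1) (ltn_trans li i1).
  - by constructor 3; exists j, k; rewrite nth_cat (ltn_trans ji i1).
have i2 : (i - size s1 < size s2)%N by rewrite ltn_subLR.
have nthE j : (s1 ++ s2)`_(size s1 + j) = s2`_j.
  by rewrite nth_cat ltnNge leq_addr /= addKn.
rewrite -(subnKC i1) nthE.
case: (d2 _ i2) => [?|[j [l [ji li h]]]|[j [k [ji k0 h]]]].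
- by constructor 1.
- by constructor 2; exists (size s1 + j)%N, (size s1 + l)%N; rewrite !nthE !ltn_add2l.
- by constructor 3; exists (size s1 + j)%N, k; rewrite !nthE !ltn_add2l.
Qed.

Lemma radical_derivation S w : radical_closure S w ->
  exists s, derivation S (rcons s w).
Proof.
have ext s w' : derivation S s ->
    [\/ S w',
      exists j l, [/\ (j < size s)%N, (l < size s)%N &
        w' = s`_j + s`_l \/ w' = s`_j * s`_l] |
      exists j k, [/\ (j < size s)%N, (0 < k)%N & w' ^+ k = s`_j]] ->
    derivation S (rcons s w').
  move=> ds h i; rewrite size_rcons ltnS leq_eqVlt => /orP[/eqP ->|is_].
    rewrite nth_rcons ltnn eqxx.
    case: h => [?|[j [l [js ls h]]]|[j [k [js k0 h]]]].
    - by constructor 1.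
    - by constructor 2; exists j, l; rewrite !nth_rcons js ls.
    - by constructor 3; exists j, k; rewrite nth_rcons js.
  rewrite nth_rcons is_; case: (ds i is_) => [?|[j [l [ji li h']]]|[j [k [ji k0 h']]]].
  - by constructor 1.
  - by constructor 2; exists j, l; rewrite !nth_rcons (ltn_trans ji is_) (ltn_trans li is_).
  - by constructor 3; exists j, k; rewrite nth_rcons (ltn_trans ji is_).
have last1 s1 s2 w1 w2 : (rcons s1 w1 ++ rcons s2 w2)`_(size s1) = w1.
  by rewrite nth_cat size_rcons leqnn nth_rcons ltnn eqxx.
have last2 s1 s2 w1 w2 : (rcons s1 w1 ++ rcons s2 w2)`_(size s1 + size s2).+1 = w2.
  by rewrite nth_cat size_rcons ltnNge ltnS leq_addr /= -addSn addKn nth_rcons ltnn eqxx.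
elim=> [u Su|u v _ [s1 d1] _ [s2 d2]|u v _ [s1 d1] _ [s2 d2]|u k k0 _ [s1 d1]].
- by exists [::]; apply: ext; [case | constructor 1].
- exists (rcons s1 u ++ rcons s2 v); apply: ext; first exact: derivation_cat.
  constructor 2; exists (size s1), (size s1 + size s2).+1.
  rewrite last1 last2 size_cat !size_rcons addSn addnS !ltnS leqW ?leq_addr //.
  by split=> //; left.
- exists (rcons s1 u ++ rcons s2 v); apply: ext; first exact: derivation_cat.
  constructor 2; exists (size s1), (size s1 + size s2).+1.
  rewrite last1 last2 size_cat !size_rcons addSn addnS !ltnS leqW ?leq_addr //.
  by split=> //; right.
exists (rcons s1 (u ^+ k)); apply: ext => //.
by constructor 3; exists (size s1), k; rewrite size_rcons nth_rcons ltnn eqxx.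
Qed.

End RadicalClosure.

Section Resolvents.
Variables (R : realType) (n : nat).
Local Notation C := (cplx R).
Local Notation W := (cpoly R n).

(** X^p - 1 has p distinct roots, because its derivative vanishes only at 0. *)
Lemma primitive_root_exists p : (0 < p)%N -> exists z : C, p.-primitive_root z.
Proof.
move=> p0; have [s sE] := closed_field_poly_normal ('X^p - 1 : {poly C}).
have sz : size ('X^p - 1 : {poly C}) = p.+1 by rewrite size_XnsubC.
have pn : (p%:R : C) != 0 by rewrite pnatr_eq0 -lt0n.
have s_uniq : uniq s.
  apply: (@simple_roots_uniq R (lead_coef ('X^p - 1))) => y; rewrite -sE => y1.
  rewrite derivB derivXn derivC subr0 hornerMn hornerXn -mulr_natr mulf_neq0 //.
  rewrite expf_eq0 negb_and; apply/orP; right; apply/eqP => y0.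
  move: y1; rewrite !hornerE y0 expr0n gtn_eqF //= sub0r => /eqP.
  by rewrite oppr_eq0 oner_eq0.
have lc : lead_coef ('X^p - 1 : {poly C}) = 1 by rewrite lead_coefXnsubC.
have ss : size s = p.
  by apply/eqP; rewrite -eqSS -sz sE lc scale1r size_prod_XsubC.
have s_root : all p.-unity_root s.
  apply/allP => y ys; rewrite unity_rootE -subr_eq0.
  have : root ('X^p - 1 : {poly C}) y by rewrite sE lc scale1r root_prod_XsubC.
  by rewrite rootE !hornerE.
have /hasP[z _ zp] := has_prim_root p0 s_root s_uniq (eq_leq (esym ss)).
by exists z.
Qed.

Definition fixed_by (G : {set {perm 'I_n}}) (w : W) := forall s, s \in G -> msym s w = w.

Definition stab (w : W) : {set {perm 'I_n}} := finset (fun s => msym s w == w).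

Lemma stab_group w : group_set (stab w).
Proof.
apply/group_setP; split; first by rewrite finset.in_set msym1m.
by move=> s t; rewrite !finset.in_set msymMm => /eqP -> /eqP ->.
Qed.

Lemma sum_cyclic_shift (F : nat -> W) p : F p = F 0%N ->
  \sum_(j < p) F j.+1 = \sum_(j < p) F j.
Proof.
case: p => [|m] Fm; first by rewrite !big_ord0.
by rewrite big_ord_recr [RHS]big_ord_recl /= Fm addrC.
Qed.

(** Lagrange resolvents: modulo the fixed ring of H, the cyclic quotient G / H
    diagonalises with roots of unity as eigenvalues, and a power of an eigenvector
    is fixed by G. *)
Lemma prime_step (G H : {group {perm 'I_n}}) (w : W) :
  fingroup.normal H G -> prime #|G : H|%g -> fixed_by H w -> radical_closure (fixed_by G) w.
Proof.
move=> /andP[HG nHG] pr wH; set p := #|G : H|%g.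
have p0 : (0 < p)%N by exact: prime_gt0.
have [sigma sG sH] : exists2 s, s \in G & s \notin H.
  apply/fintype.subsetPn; apply/negP => GH; have := pr.
  by rewrite (_ : #|G : H|%g = 1%N) //; apply/eqP; rewrite indexg_eq1.
have spH : (sigma ^+ p)%g \in H.
  have sN := fintype.subsetP nHG _ sG.
  apply: coset_idr; first exact: groupX.
  rewrite morphX //; have : coset H sigma \in (G / H)%g by exact: mem_quotient.
  by move=> /order_dvdG; rewrite card_quotient // order_dvdn => /eqP.
(* H is a maximal subgroup of G, so the stabiliser of u is G. *)
have fixG u : fixed_by H u -> msym sigma u = u -> fixed_by G u.
  move=> uH us; pose K := Group (stab_group u).
  have HK : H \subset K :&: G.
    rewrite finset.subsetI HG andbT; apply/fintype.subsetP => s /uH us'.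
    by rewrite finset.in_set us'.
  have := p_index_maximal HG pr => /maxgroupP[_].
  have [KG|KG] := boolP (K :&: G \proper G)%g.
    move=> /(_ _ KG HK) /= E; case/negP: sH; rewrite -E finset.in_setI sG andbT finset.in_set.
    by apply/eqP.
  move=> _ s sG'; have : G \subset K :&: G by move: KG; rewrite properE finset.subsetIr negbK.
  by move=> /fintype.subsetP/(_ s sG'); rewrite !(finset.in_setI, finset.in_set) => /andP[/eqP].
have constG (c : C) : fixed_by G (mpolyC n c) by move=> s _; rewrite /msym mmapC.
have [z zp] := primitive_root_exists p0.
have z1 : z ^+ p = 1 := prim_expr_order zp.
have z0 : z != 0.
  by apply/eqP => z0; move: z1; rewrite z0 expr0n gtn_eqF //= => /eqP; rewrite eq_sym oner_eq0.
pose F (a j : nat) : W := z^-1 ^+ (a * j) *: msym (sigma ^+ j)%g w.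
pose r (a : nat) : W := \sum_(j < p) F a j.
have FS a j : msym sigma (F a j) = z ^+ a *: F a j.+1.
  rewrite /F msymZ -msymMm -expgSr scalerA; congr (_ *: _).
  have zz : z ^+ a * z^-1 ^+ a = 1 by rewrite -exprMn mulfV // expr1n.
  by rewrite mulnS exprD mulrA zz mul1r.
have Fp a : F a p = F a 0%N.
  rewrite /F muln0 expr0 mulnC exprM exprVn z1 invr1 !expr1n.
  by rewrite expg0 msym1m (wH _ spH).
have Fshift a : \sum_(j < p) F a j.+1 = r a.
  exact: sum_cyclic_shift (Fp a).
have r_eigen a : msym sigma (r a) = z ^+ a *: r a.
  rewrite -{2}Fshift scaler_sumr /r raddf_sum /=.
  by apply: eq_bigr => j _; exact: FS.
have r_H a : fixed_by H (r a).
  move=> h hH; rewrite /r raddf_sum /=; apply: eq_bigr => j _.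
  have conj_h : (sigma ^+ j * h = (h ^ (sigma ^- j)) * sigma ^+ j)%g.
    by rewrite conjgE invgK mulgA mulgKV.
  have hjH : (h ^ (sigma ^- j))%g \in H.
    by rewrite memJ_norm // groupV groupX // (fintype.subsetP nHG).
  have fj : msym h (msym (sigma ^+ j)%g w) = msym (sigma ^+ j)%g w.
    by rewrite -(msymMm w (sigma ^+ j)%g h) conj_h msymMm (wH _ hjH).
  exact: etrans (msymZ _ _ _) (congr1 _ fj).
have r_rad a : radical_closure (fixed_by G) (r a).
  apply: (rc_root p0); apply: rc_base; apply: fixG.
    by move=> h hH; rewrite rmorphXn /= r_H.
  by rewrite rmorphXn /= r_eigen exprZn -exprM mulnC exprM z1 expr1n scale1r.
have sumr : \sum_(a < p) r a = p%:R *: w.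
  rewrite /r exchange_big /= (bigD1 (Ordinal p0)) //= [X in _ + X]big1 ?addr0.
    rewrite (eq_bigr (fun=> w)) => [|a _]; last first.
      by rewrite /F muln0 expr0 scale1r expg0 msym1m.
    by rewrite sumr_const card_ord scaler_nat.
  move=> j j0; rewrite /F -scaler_suml; apply/eqP; rewrite scaler_eq0; apply/orP; left.
  pose u := z^-1 ^+ j; have u1 : u != 1.
    rewrite /u exprVn invr_eq1 -(prim_order_dvd zp) gtnNdvd ?ltn_ord // lt0n.
    by apply: contra j0 => /eqP j0; apply/eqP/val_inj.
  rewrite (eq_bigr (fun a : 'I_p => u ^+ a)) => [|a _]; last by rewrite /u -exprM mulnC.
  have : (u - 1) * \sum_(a < p) u ^+ a = 0.
    by rewrite -subrX1 /u -exprM mulnC exprM exprVn z1 invr1 expr1n subrr.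
  by move/eqP; rewrite mulf_eq0 subr_eq0 (negPf u1).
have pn : (p%:R : C) != 0 by rewrite pnatr_eq0 -lt0n.
have -> : w = mpolyC n (p%:R^-1) * \sum_(a < p) r a.
  by rewrite sumr mul_mpolyC scalerA mulVf // scale1r.
apply: rc_mul; first by apply: rc_base; exact: constG.
apply: rc_sum => [|a]; last exact: r_rad.
by apply: rc_base => s _; rewrite msym0.
Qed.

Lemma solvable_radical (G : {group {perm 'I_n}}) (w : W) :
  solvable G -> radical_closure (fixed_by G) w.
Proof.
move: {2}#|G|.+1 (ltnSn #|G|) => m; elim: m G => // m IH G.
rewrite ltnS => Gm solG; have [G1|G1] := eqVneq (G : {set _}) 1%g.
  by apply: rc_base => s; rewrite G1 inE => /eqP ->; rewrite msym1m.
have [H nHG pr] := sol_prime_factor_exists solG G1.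
apply: (@radical_closure_trans _ (fixed_by H)) => [u|]; first exact: prime_step nHG pr.
apply: IH; last exact: solvableS (normal_sub nHG) solG.
apply: leq_trans Gm; apply: proper_card; rewrite finset.properEneq normal_sub // andbT.
by apply/eqP => HG; move: pr; rewrite HG indexgg.
Qed.

End Resolvents.

Theorem theorem6 (R : realType) (N : nat) (P : {poly cpoly R N})
    (P_irr : irreducible_equation P)
    (x0 : cspace R N) (x0_notin : ~ Sigma P x0)
    (ys : 'I_(size P).-1 -> cspace R N -> cplx R)
    (ys_germs : lists_germs_of P x0 ys) :
  solvable (monodromy_group P x0 ys) ->
  representable_by_radicals P.
Proof.
move=> sol; have P_gt1 : (1 < size P)%N.
  have tI : injective (@tofrac (cpoly R N)) by move=> u v /eqP; rewrite tofrac_eq => /eqP.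
  by case: P_irr; rewrite (size_map_inj_poly tI (rmorph0 _)).
pose G := Group (monodromy_group_set x0_notin ys_germs).
have n0 : (0 < (size P).-1)%N by rewrite -subn1 subn_gt0.
pose i0 := Ordinal n0.
have rad0 : radical_closure (fixed_by G) (mpolyX (cplx R) (mnm1 i0)).
  exact: (solvable_radical _ (sol : solvable G)).
have [s ds] := radical_derivation rad0.
set t := rcons s _ in ds.
pose ev (w : cpoly R (size P).-1) x : cplx R := meval (fun i => ys i x) w.
have evD u v x : ev (u + v) x = ev u x + ev v x by exact: mevalD.
have evM u v x : ev (u * v) x = ev u x * ev v x by exact: mevalM.
have ev_fixed w : fixed_by G w -> is_rational_germ x0 (ev w).
  move=> /(invariant_rational P_gt1 x0_notin ys_germs)[Q QP].
  have [l0 _] := SigmaN x0_notin.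
  exists Q, (lead_coef P ^+ msize w); split; first by rewrite rmorphXn /= expf_neq0.
  have near_xS := SigmaN_near x0_notin.
  rewrite /germ_eq; apply: filterS2 QP near_xS => x <- /SigmaN[lx _].
  by rewrite rmorphXn /= mulrC mulKf // expf_neq0.
have st : size t = (size s).+1 by rewrite size_rcons.
exists x0, (size s), (fun i => ev t`_i); split.
- move=> i; apply: analytic_meval => j.
  by have [ysg _ _] := ys_germs; case: (ysg j).
- move=> i; have it : (i < size t)%N by rewrite st.
  have small j : (j < i)%N -> (j < (size s).+1)%N by move=> /ltn_trans; apply.
  case: (ds i it) => [/ev_fixed h|[j [l [ji li h]]]|[j [k [ji k0 h]]]].
  + by constructor 1.
  + constructor 2; exists (Ordinal (small _ ji)), (Ordinal (small _ li)); split=> //.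
    case: h => ->; [constructor 1 | constructor 3]; apply: filterE => x.
      exact: evD.
    exact: evM.
  constructor 3; exists (Ordinal (small _ ji)), k; split=> //=.
  by apply: filterE => x; rewrite -h /ev rmorphXn.
rewrite /= nth_rcons ltnn eqxx.
have [ysg _ _] := ys_germs; have := ysg i0; congr (is_germ_of P x0 _).
by apply/funext => x; rewrite /ev mevalXU.
Qed.
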